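(* Let $1<p<\infty$, and suppose that $f\in H^p$ with $f(0)\neq 0$. If $q_{1,p}[f](z)=a(z-w)$ for some $a,w\in\mathbb{C}$, then \[ |a|^{r-1} \leq \frac{r|wf(0)|}{K_1\|(z-w)f(z)+wf(0)\|_p^r + K_1\|(z-w)f(z)\|_p^r}, \] where $r$ and $K_1$ are the lower Pythagorean parameters.
   Context: $H^p$ denotes the classical Hardy space of holomorphic functions on the open unit disk $\mathbb{D}$, with norm $\|f\|_p = \left(\sup_{0\le \rho<1}\frac{1}{2\pi}\int_0^{2\pi}|f(\rho e^{i\theta})|^p\,d\theta\right)^{1/p}$; expressions such as $\|(z-w)f(z)\|_p$ denote the norm of the function of $z$ displayed. For an integer $n\ge 0$ let $\mathcal{P}_n$ be the set of complex polynomials of degree at most $n$. For $1<p<\infty$ and $f\in H^p$, not identically zero, the $n$-th optimal polynomial approximant (OPA) to $1/f$ in $H^p$, denoted $q_{n,p}[f]$, is the unique polynomial $q\in\mathcal{P}_n$ minimizing $\|1-qf\|_p$ over $\mathcal{P}_n$. The lower Pythagorean parameters are: $r=2$, $K_1=p-1$ if $1<p\le 2$; and $r=p$, $K_1=\frac{1}{2^{p-1}-1}$ if $2\le p<\infty$. (They are the parameters for which $\|x+y\|_p^r\ge \|x\|_p^r+K_1\|y\|_p^r$ whenever $x\perp_p y$ in $L^p$, where $x\perp_p y$ means $\|x+\beta y\|_p\ge\|x\|_p$ for all scalars $\beta$.) *)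

(* Defs.v *)
From HB Require Import structures.
From mathcomp Require Import all_boot all_order all_algebra.
From mathcomp Require Import complex.
From mathcomp Require Import all_classical all_reals all_analysis.

Set Implicit Arguments.
Unset Strict Implicit.
Unset Printing Implicit Defensive.

Import Order.TTheory GRing.Theory Num.Theory.
Import numFieldNormedType.Exports.

Local Open Scope classical_set_scope.
Local Open Scope ring_scope.

(* The order and the norm [`|z|] of [R[i]] take values in [R[i]]; the
   real-valued modulus is [normc]. *)
Notation cabs := ComplexField.Normc.normc.

Section Hardy.
Context {R : realType}.
Implicit Types (p rho theta : R) (f : R[i] -> R[i]).

(* A function on the disk is encoded as a total function on [R[i]] of which
   only the values on the open disk are ever used. [derivable f z 1] over the
   field [R[i]] is complex differentiability at [z]. *)
Definition holomorphic_disk f : Prop :=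
  forall z : R[i], cabs z < 1 -> derivable (f : R[i]^o -> R[i]^o) z 1.

Definition circle_pt rho theta : R[i] :=
  (rho * cos theta +i* (rho * sin theta))%C.

Definition circle_mean p f rho : \bar R :=
  (((2 * pi)^-1)%:E *
   \int[lebesgue_measure]_(theta in `[0%R, (2 * pi)%R])
     ((cabs (f (circle_pt rho theta))) `^ p)%:E)%E.

Definition hardy_norm p f : \bar R :=
  (ereal_sup [set circle_mean p f rho | rho in [set` `[0%R, 1%R[ ]] `^ p^-1)%E.

Definition hardy p f : Prop :=
  holomorphic_disk f /\ (hardy_norm p f < +oo)%E.

(* Recall that [size q] is the degree of [q] plus one. *)
Definition is_opa p (n : nat) f (q : {poly R[i]}) : Prop :=
  (size q <= n.+1)%N /\
  forall g : {poly R[i]}, (size g <= n.+1)%N ->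
    (hardy_norm p (fun z => (1 - q.[z] * f z)%R) <=
     hardy_norm p (fun z => (1 - g.[z] * f z)%R))%E.

Definition pyth_r p : R := if p <= 2 then 2 else p.

Definition pyth_K p : R :=
  if p <= 2 then p - 1 else (2 `^ (p - 1) - 1)^-1.

End Hardy.

(* Main.v *)
Require Import Defs.
From HB Require Import structures.
From mathcomp Require Import all_boot all_order all_algebra.
From mathcomp Require Import complex.
From mathcomp Require Import all_classical all_reals all_analysis.
From mathcomp Require Import measurable_realfun ring lra.

Set Implicit Arguments.
Unset Strict Implicit.
Unset Printing Implicit Defensive.

Import Order.TTheory GRing.Theory Num.Theory.
Import numFieldNormedType.Exports.
Import ComplexField.Normc.

Local Open Scope classical_set_scope.
Local Open Scope ring_scope.

(** Write [F z = (z - w) * f z], so that [q f = a F]. Minimality of [q] among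
    its own real multiples says that [1 - a F] is orthogonal, in the sense of
    Birkhoff and James, to [a F], and the sum of the two is the constant 1.
    Constants are orthogonal to every function that vanishes at the origin,
    because the norm dominates the value there; and [1 - a F] is the sum of the
    constant [c = 1 + a w f(0)] and of [- a (F + w f(0))], which vanishes at 0.
    Two applications of the lower Pythagorean inequality [hardy_pythagoras]
    therefore give
      [|c|^r + K |a|^r ||F + w f(0)||^r + K |a|^r ||F||^r <= 1],
    and Bernoulli's inequality [|c|^r >= 1 - r |a w f(0)|] turns this into the
    claim after a division by [|a|].

    The Pythagorean inequality comes from a weak parallelogram law
      [||x + y||^r + C ||x - y||^r <= 2^(r-1) (||x||^r + ||y||^r)],
    applied to the pairs [x + t y], [x] with [t = 2^-n]: it bounds the excess
    [||x + t y||^r - ||x||^r] below by twice the excess for [t / 2] plus a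
    multiple of [t^r ||y||^r], and the geometric series so obtained
    ([halving_iteration]) sums to the constant [K].

    On a single circle the law is an inequality in [L^p]: Clarkson's inequality
    for [p > 2], and for [p <= 2] the two-point inequality [two_point_complex]
    integrated with the help of the reverse Minkowski inequality. To pass to
    the supremum over all radii one must know that the norms of [x + y] and of
    [x - y] are approached along the same circles, that is, that the p-means of
    a holomorphic function increase with the radius ([pmean_nondecreasing]).

    Holomorphy only means complex differentiability at each point, so this
    monotonicity starts from Goursat's bisection argument. It is carried out in
    polar coordinates, where it directly yields that the integral of [Re h]
    over a circle around the origin does not depend on the radius
    ([mean_value]). Convexity of the p-th power gives the submean inequality
    for [|h|^p]; averaging over rotations turns it into a submean inequality for
    the radial function [pmean]; and a maximum principle for radial functions
    ([radial_maximum]) concludes. *)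

(** * Complex numbers: the modulus and complex differentiability *)

Section Modulus.
Context {R : realType}.
Implicit Types z w : R[i].

Lemma norm_cabs z : `|z| = (cabs z)%:C%C.
Proof. by []. Qed.

Lemma cabs_ge0 z : 0 <= cabs z.
Proof. by case: z => a b; exact: sqrtr_ge0. Qed.

Lemma Re_le_cabs z : `|complex.Re z| <= cabs z.
Proof. by rewrite -lecR -norm_cabs normc_ge_Re. Qed.

Lemma Im_le_cabs z : `|complex.Im z| <= cabs z.
Proof.
case: z => a b /=; rewrite -sqrtr_sqr ler_sqrt ?addr_ge0 ?sqr_ge0//.
by rewrite lerDr sqr_ge0.
Qed.

Lemma cabsD z w : cabs (z + w) <= cabs z + cabs w.
Proof. exact: le_normcD. Qed.

Lemma cabsN z : cabs (- z) = cabs z.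
Proof. exact: normcN. Qed.

Lemma cabsE z : cabs z = Num.sqrt (complex.Re z ^+ 2 + complex.Im z ^+ 2).
Proof. by case: z. Qed.

Lemma continuous_Re : continuous (@complex.Re R : R[i]^o -> R).
Proof.
move=> z; have FF : Filter (nbhs (z : R[i]^o)) by exact: nbhs_filter.
apply/cvgrPdist_lt => e e0; exists e%:C%C; first by rewrite /= ltcR.
move=> w; rewrite /ball_/= norm_cabs ltcR; apply: le_lt_trans.
by rewrite -raddfB Re_le_cabs.
Qed.

Lemma continuous_Im : continuous (@complex.Im R : R[i]^o -> R).
Proof.
move=> z; have FF : Filter (nbhs (z : R[i]^o)) by exact: nbhs_filter.
apply/cvgrPdist_lt => e e0; exists e%:C%C; first by rewrite /= ltcR.
move=> w; rewrite /ball_/= norm_cabs ltcR; apply: le_lt_trans.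
by rewrite -raddfB Im_le_cabs.
Qed.

Lemma continuous_real_complex : continuous (real_complex R : R -> R[i]^o).
Proof.
move=> x; apply/(@cvgrPdist_lt _ R[i]^o) => e e0.
have [e1 ee] : exists e1, e = e1%:C%C.
  by apply/complex_realP; rewrite realE ltW.
move: e0; rewrite {}ee ltcR => e0; apply/nbhs_ballP; exists e1 => //.
by move=> y xy; rewrite -rmorphB norm_cabs/= expr0n addr0 sqrtr_sqr ltcR.
Qed.

Lemma continuous_cabs : continuous (fun z : R[i]^o => cabs z).
Proof.
move=> z; have FF : Filter (nbhs (z : R[i]^o)) by exact: nbhs_filter.
under eq_fun do rewrite cabsE.
apply: (@continuous_comp _ _ _ (fun z : R[i]^o =>
  complex.Re z ^+ 2 + complex.Im z ^+ 2) Num.sqrt); last exact: sqrt_continuous.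
have := @continuous_Re z; have := @continuous_Im z => ci cr.
by apply: cvgD; apply: cvgM.
Qed.

(** The absolute value makes the power continuous on the whole line: [powR]
    itself jumps at 0, since it is 1 on negative reals. *)
Lemma continuous_abs_powR (q : R) : 0 < q -> continuous (fun x : R => `|x| `^ q).
Proof.
move=> q0 x.
have [x0|x0] := eqVneq x 0; last first.
  have nx : {for x, continuous (fun x : R => `|x|)} by exact: norm_continuous.
  suff px : {for `|x|, continuous (fun y : R => y `^ q)}.
    exact: (@continuous_comp R R R (fun x : R => `|x|) (fun y => y `^ q) x nx px).
  apply: differentiable_continuous; apply/derivable1_diffP.
  by apply: ex_derive; apply: is_derive1_powR; rewrite normr_gt0.
rewrite /continuous_at x0 normr0 powR0 ?gt_eqF//.
apply/cvgrPdist_lt => e e0; apply/nbhs_ballP; exists (e `^ q^-1).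
  by rewrite /= powR_gt0.
move=> y; rewrite /ball/= !sub0r !normrN => ye.
rewrite ger0_norm ?powR_ge0//.
have -> : e = (e `^ q^-1) `^ q by rewrite -powRrM mulVf ?gt_eqF// powRr1// ltW.
by rewrite gt0_ltr_powR// nnegrE ?powR_ge0.
Qed.

Lemma holomorphic_continuous (h : R[i] -> R[i]) z :
  derivable (h : R[i]^o -> R[i]^o) z 1 ->
  {for z, continuous (h : R[i]^o -> R[i]^o)}.
Proof.
by move=> /derivable1_diffP; exact: differentiable_continuous.
Qed.

(** Complex differentiability in terms of the real modulus: the form in which
    Goursat's argument consumes it. *)
Lemma complex_linear_approx (h : R[i] -> R[i]) z :
  derivable (h : R[i]^o -> R[i]^o) z 1 -> exists d, forall e : R, 0 < e ->
  exists2 dl : R, 0 < dl & forall w, cabs (w - z) < dl ->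
   cabs (h w - h z - d * (w - z)) <= e * cabs (w - z).
Proof.
move=> dh; exists ('D_1 (h : R[i]^o -> R[i]^o) z) => e e0.
move: dh => /cvg_ex[d dh]; rewrite /derive (cvg_lim _ dh)//.
move/(@cvgrPdist_lt _ R[i]^o) : dh => /(_ e%:C%C); rewrite ltcR => /(_ e0).
move/nbhs_ballP => [dl dl0 H].
have [d1 ee] : exists d1, dl = d1%:C%C.
  by apply/complex_realP; rewrite realE ltW.
exists d1; first by move: dl0; rewrite ee /= ltcR.
move=> w; have [->|wz] := eqVneq w z; first by rewrite !subrr mulr0 subr0 normc0 mulr0 lexx.
move=> wd.
have /= := H (w - z).
rewrite /ball/= sub0r normrN norm_cabs ee ltcR => /(_ wd); rewrite subr_eq0 => /(_ wz).
rewrite norm_cabs ltcR => K.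
have -> : h w - h z - d * (w - z) =
   - (w - z) * (d - (w - z)^-1 * (h ((w - z) * 1 + z) - h z)).
  rewrite mulr1 subrK.
  have E : (w - z) * (w - z)^-1 = 1 by rewrite divff ?subr_eq0.
  transitivity ((w - z) * (w - z)^-1 * (h w - h z) - d * (w - z)).
    by rewrite E mul1r.
  by ring.
by rewrite normcM cabsN mulrC ler_wpM2r ?cabs_ge0// ltW.
Qed.
End Modulus.

(** * Additive rectangle functions of vanishing density *)

Section Bisect.
Context {R : realType}.
Implicit Types (a b c d x y : R).

(** Goursat's bisection: of the four quarters of a rectangle, one carries at
    least a quarter of [|J|]. The nested rectangles so chosen shrink to a point,
    where the assumption that [J] is small compared with the square of the
    perimeter contradicts the factor [4^-n]. *)
Lemma additive_rectangle_eq0 (J : R -> R -> R -> R -> R) (A B C D : R) :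
  A <= B -> C <= D ->
  (forall a m b c d, A <= a -> a <= m -> m <= b -> b <= B -> C <= c -> c <= d ->
     d <= D -> J a b c d = J a m c d + J m b c d) ->
  (forall a b c m d, A <= a -> a <= b -> b <= B -> C <= c -> c <= m -> m <= d ->
     d <= D -> J a b c d = J a b c m + J a b m d) ->
  (forall x y e, A <= x <= B -> C <= y <= D -> 0 < e -> exists2 dl, 0 < dl &
     forall a b c d, A <= a -> a <= x <= b -> b <= B ->
       C <= c -> c <= y <= d -> d <= D -> b - a < dl -> d - c < dl ->
     `|J a b c d| <= e * ((b - a) + (d - c)) ^+ 2) ->
  J A B C D = 0.
Proof.
move=> AB CD spr spt small.
apply/eqP; rewrite -normr_eq0 -[_ == _]negbK; apply/negP => J0.
set eta := `|J A B C D| in J0.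
have {}J0 : 0 < eta by rewrite lt_neqAle eq_sym J0 normr_ge0.
pose l n : R := (B - A) / 2 ^+ n; pose k n : R := (D - C) / 2 ^+ n.
have two_gt0 n : (0 : R) < 2 ^+ n by exact: exprn_gt0.
have l0 n : 0 <= l n by rewrite divr_ge0 ?subr_ge0// ltW.
have k0 n : 0 <= k n by rewrite divr_ge0 ?subr_ge0// ltW.
have lS n : l n = l n.+1 + l n.+1.
  by rewrite /l exprS; have := gt_eqF (two_gt0 n) => /negbT ?; field.
have kS n : k n = k n.+1 + k n.+1.
  by rewrite /k exprS; have := gt_eqF (two_gt0 n) => /negbT ?; field.
pose good (s : R * R * nat) := let: (x, y, n) := s in
  [/\ A <= x, x + l n <= B, C <= y, y + k n <= D &
      eta / 4 ^+ n <= `|J x (x + l n) y (y + k n)| ].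
pose T := {s | good s}.
pose step (s s' : T) := let: (x, y, n) := sval s in let: (x', y', n') := sval s' in
  [/\ n' = n.+1, x <= x', x' + l n' <= x + l n, y <= y' & y' + k n' <= y + k n].
have stepP s : {s' | step s s'}.
  apply/cid; case: s => [[[x y] n] sg]; rewrite /step /=.
  have [Ax xB Cy yD JJ'] := sg.
  have JJ : 4 * (eta / 4 ^+ n.+1) <= `|J x (x + l n) y (y + k n)|.
    apply: le_trans JJ'; rewrite exprS.
    have : (4 : R) ^+ n != 0 by rewrite expf_neq0.
    by move=> ?; rewrite le_eqVlt; apply/orP; left; apply/eqP; field.
  have := l0 n.+1; have := k0 n.+1.
  move: JJ xB yD {JJ'}; rewrite (lS n) (kS n) !addrA.
  set h := l n.+1; set q := k n.+1 => JJ xB yD q0 h0.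
  have := JJ.
  rewrite (spr x (x + h) (x + h + h)) ?lerDl//; [|by lra..].
  rewrite (spt x (x + h) y (y + q)) ?lerDl//; [|by lra..].
  rewrite (spt (x + h) (x + h + h) y (y + q)) ?lerDl//; [|by lra..].
  set J1 := J x _ y _; set J2 := J x _ (y + q) _.
  set J3 := J (x + h) _ y _; set J4 := J (x + h) _ (y + q) _.
  move=> J1234.
  have tri : `|J1 + J2 + (J3 + J4)| <= `|J1| + `|J2| + `|J3| + `|J4|.
    by rewrite (le_trans (ler_normD _ _))// -addrA lerD// ler_normD.
  have [H|H1] := leP (eta / 4 ^+ n.+1) `|J1|.
    have g : good (x, y, n.+1) by split; rewrite -?/h -?/q //; lra.
    by exists (exist _ _ g) => /=; rewrite -?/h -?/q; split => //; lra.
  have [H|H2] := leP (eta / 4 ^+ n.+1) `|J2|.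
    have g : good (x, y + q, n.+1) by split; rewrite -?/h -?/q //; lra.
    by exists (exist _ _ g) => /=; rewrite -?/h -?/q; split => //; lra.
  have [H|H3] := leP (eta / 4 ^+ n.+1) `|J3|.
    have g : good (x + h, y, n.+1) by split; rewrite -?/h -?/q //; lra.
    by exists (exist _ _ g) => /=; rewrite -?/h -?/q; split => //; lra.
  have [H|H4] := leP (eta / 4 ^+ n.+1) `|J4|.
    have g : good (x + h, y + q, n.+1) by split; rewrite -?/h -?/q //; lra.
    by exists (exist _ _ g) => /=; rewrite -?/h -?/q; split => //; lra.
  exfalso; lra.
have g0 : good (A, C, 0%N).
  by split => //; rewrite /l /k !expr0 !divr1 ?subrKC.
have [f [f0 fS]] := dependent_choice stepP (exist _ _ g0).
pose X n := (sval (f n)).1.1; pose Y n := (sval (f n)).1.2.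
have fE n : (sval (f n)).2 = n.
  elim: n => [|n IH]; first by rewrite f0.
  by have := fS n; rewrite /step; move: IH; case: (sval (f n)) => -[? ?] ? /= ->;
    case: (sval (f n.+1)) => -[? ?] ? /= [].
have fg n : [/\ A <= X n, X n + l n <= B, C <= Y n, Y n + k n <= D &
      eta / 4 ^+ n <= `|J (X n) (X n + l n) (Y n) (Y n + k n)| ].
  have := svalP (f n); have := fE n; rewrite /X /Y.
  by case: (sval (f n)) => -[? ?] ? /= ->.
have fs n : [/\ X n <= X n.+1, X n.+1 + l n.+1 <= X n + l n,
    Y n <= Y n.+1 & Y n.+1 + k n.+1 <= Y n + k n].
  have := fS n; have := fE n; have := fE n.+1; rewrite /step /X /Y.
  by case: (sval (f n)) => -[? ?] ? /=; case: (sval (f n.+1)) => -[? ?] ? /= -> -> [].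
have limit (Z w : nat -> R) : (forall n, 0 <= w n) ->
    (forall n, Z n <= Z n.+1 /\ Z n.+1 + w n.+1 <= Z n + w n) ->
    exists z, forall n, Z n <= z <= Z n + w n.
  move=> w0 mon.
  have Zm m n : (m <= n)%N -> Z m <= Z n /\ Z n + w n <= Z m + w m.
    move=> /subnK <-; elim: (n - m)%N => // j [IH1 IH2]; rewrite addSn.
    by have [? ?] := mon (j + m)%N; split; [exact: le_trans IH1 _|exact: le_trans IH2].
  have ZZ m n : Z m <= Z n + w n.
    have [mn|/ltnW nm] := leqP m n.
      by rewrite (le_trans (Zm _ _ mn).1)// lerDl.
    by rewrite (le_trans _ (Zm _ _ nm).2)// lerDl.
  exists (sup (range Z)) => n; apply/andP; split.
    apply: ub_le_sup; last by exists n.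
    by exists (Z 0%N + w 0%N) => _ [m _ <-].
  apply: ge_sup; first by exists (Z 0%N), 0%N.
  by move=> _ [m _ <-].
(* [x] and [y] are the coordinates of the point common to all chosen
   rectangles. *)
have [|x xP] := limit X l l0; first by move=> n; have [] := fs n.
have [|y yP] := limit Y k k0; first by move=> n; have [] := fs n.
set S := (B - A) + (D - C).
have S0 : 0 <= S by rewrite addr_ge0 ?subr_ge0.
(* Chosen so that [e * S ^+ 2 < eta]; the 1 covers a degenerate rectangle. *)
pose e := eta / (S ^+ 2 + 1).
have S1 : 0 < S ^+ 2 + 1 by rewrite ltr_wpDl ?sqr_ge0.
have e0 : 0 < e by rewrite divr_gt0.
have xAB : A <= x <= B.
  by have [? ? _ _ _] := fg 0%N; have := xP 0%N; lra.
have yCD : C <= y <= D.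
  by have [_ _ ? ? _] := fg 0%N; have := yP 0%N; lra.
have [dl dl0 H] := small x y e xAB yCD e0.
have [n ndl] : exists n : nat, S / 2 ^+ n < dl.
  pose n := Num.bound (S / dl); exists n.
  rewrite ltr_pdivrMr// mulrC -ltr_pdivrMr//.
  have := archi_boundP (divr_ge0 S0 (ltW dl0)); rewrite -/n => /lt_trans; apply.
  by rewrite -natrX ltr_nat ltn_expl.
have [Ax xB Cy yD] := fg n; apply/negP; rewrite -ltNge.
have lk : l n + k n = S / 2 ^+ n by rewrite /l /k -mulrDl.
have := l0 n; have := k0 n => kn ln.
have := H (X n) (X n + l n) (Y n) (Y n + k n) Ax (xP n) xB Cy (yP n) yD.
rewrite !(addrC _ (l n)) !(addrC _ (k n)) !addrK lk => /(_ _ _)/le_lt_trans; apply; [lra|lra|].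
have -> : e * (S / 2 ^+ n) ^+ 2 = e * S ^+ 2 / 4 ^+ n.
  rewrite expr_div_n mulrA -exprM mulnC exprM; congr (_ / _ ^+ _).
  by rewrite expr2; lra.
rewrite ltr_pM2r ?invr_gt0 ?exprn_gt0// /e mulrAC ltr_pdivrMr//.
by rewrite ltr_pM2l// ltrDl.
Qed.
End Bisect.

(** * Integrals of continuous functions over segments, and circles *)

Section Seg.
Context {R : realType}.
Implicit Types (a b c m M k : R) (f g F : R -> R).
Notation mu := (@lebesgue_measure R).

Definition segint a b f := (\int[mu]_(x in `[a, b]) f x)%R.

(** Continuity at each point of the segment, two-sided at the end points: it is
    stable under the operations used below and implies continuity within. *)
Definition cts_on a b f := forall x, a <= x <= b -> {for x, continuous f}.

Lemma cts_on_within a b f : cts_on a b f -> {within `[a, b], continuous f}.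
Proof.
by move=> cf; apply: continuous_in_subspaceT => x; rewrite inE/= in_itv/=; exact: cf.
Qed.

Lemma cts_on_integrable a b f : cts_on a b f -> mu.-integrable `[a, b] (EFin \o f).
Proof.
move=> cf; apply: continuous_compact_integrable; first exact: segment_compact.
exact: cts_on_within.
Qed.

Lemma cts_onD a b f g : cts_on a b f -> cts_on a b g -> cts_on a b (fun x => f x + g x).
Proof. by move=> cf cg x xab; apply: cvgD; [exact: cf|exact: cg]. Qed.

Lemma cts_onB a b f g : cts_on a b f -> cts_on a b g -> cts_on a b (fun x => f x - g x).
Proof. by move=> cf cg x xab; apply: cvgB; [exact: cf|exact: cg]. Qed.

Lemma cts_onM a b f g : cts_on a b f -> cts_on a b g -> cts_on a b (fun x => f x * g x).
Proof. by move=> cf cg x xab; apply: cvgM; [exact: cf|exact: cg]. Qed.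

Lemma cts_on_cst a b k : cts_on a b (fun=> k).
Proof. by move=> x _; exact: cvg_cst. Qed.

Lemma cts_onW a b f : continuous f -> cts_on a b f.
Proof. by move=> cf x _; exact: cf. Qed.

Lemma segintD a b f g : cts_on a b f -> cts_on a b g ->
  segint a b (fun x => f x + g x) = segint a b f + segint a b g.
Proof. by move=> cf cg; apply: RintegralD => //; exact: cts_on_integrable. Qed.

Lemma segintB a b f g : cts_on a b f -> cts_on a b g ->
  segint a b (fun x => f x - g x) = segint a b f - segint a b g.
Proof. by move=> cf cg; apply: RintegralB => //; exact: cts_on_integrable. Qed.

Lemma segintZ a b k f : cts_on a b f -> segint a b (fun x => k * f x) = k * segint a b f.
Proof. by move=> cf; apply: RintegralZl => //; exact: cts_on_integrable. Qed.

Lemma eq_segint a b f g : (forall x, a <= x <= b -> f x = g x) -> segint a b f = segint a b g.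
Proof. by move=> fg; apply: eq_Rintegral => x; rewrite inE/= in_itv/=; exact: fg. Qed.

Lemma segint_cst a b k : a <= b -> segint a b (fun=> k) = k * (b - a).
Proof.
move=> ab; rewrite /segint Rintegral_cst//= lebesgue_measure_itv/= lte_fin.
have [_|ba] //= := ltrP a b.
by have -> : b = a; [lra|rewrite subrr].
Qed.

Lemma segint_le a b f g : cts_on a b f -> cts_on a b g ->
  (forall x, a <= x <= b -> f x <= g x) -> segint a b f <= segint a b g.
Proof.
move=> cf cg fg; apply: le_Rintegral => //.
- exact: cts_on_integrable.
- exact: cts_on_integrable.
Qed.

Lemma segint_abs_le a b f M : a <= b -> cts_on a b f ->
  (forall x, a <= x <= b -> `|f x| <= M) -> `|segint a b f| <= M * (b - a).
Proof.
move=> ab cf fM; rewrite ler_norml -mulNr -!segint_cst//; apply/andP; split.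
  by apply: segint_le => //; [exact: cts_on_cst|move=> x /fM; rewrite ler_norml => /andP[]].
by apply: segint_le => //; [exact: cts_on_cst|move=> x /fM; rewrite ler_norml => /andP[]].
Qed.

Lemma segint_split a m b f : a <= m -> m <= b -> cts_on a b f ->
  segint a b f = segint a m f + segint m b f.
Proof.
move=> am mb cf.
have := @Rintegral_itvB R f (BLeft a) (BRight b) m (cts_on_integrable cf).
rewrite !bnd_simp => /(_ am mb).
rewrite Rintegral_itv_obnd_cbnd; last first.
  apply: integrableS (cts_on_integrable cf) => //.
  by apply: subset_itv; rewrite bnd_simp.
by rewrite /segint => <-; rewrite addrC subrK.
Qed.

Lemma segint_FTC a b f F : a <= b -> continuous f ->
  (forall x, is_derive x (1 : R) F (f x)) -> segint a b f = F b - F a.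
Proof.
rewrite le_eqVlt => /predU1P[-> _ _|ab cf dF].
  by rewrite /segint set_itv1 Rintegral_set1 subrr.
rewrite /segint /Rintegral (@continuous_FTC2 _ f F)//.
- exact/cts_on_within/cts_onW.
- have cF : continuous F.
    by move=> x; apply: differentiable_continuous; exact/derivable1_diffP.
  split; [by move=> x _|exact/cvg_at_right_filter/cF|exact/cvg_at_left_filter/cF].
- by move=> x _; rewrite derive1E derive_val.
Qed.
End Seg.

Section Polar.
Context {R : realType}.
Implicit Types (a b c d m r t x y : R) (z w : R[i]) (h : R[i] -> R[i]).
Notation P := circle_pt.

Lemma cabs_circle_pt r t : cabs (P r t) = `|r|.
Proof.
by rewrite cabsE /= !exprMn -mulrDr cos2Dsin2 mulr1 sqrtr_sqr.
Qed.

Lemma circle_ptD2pi r t : P r (t + 2 * pi) = P r t.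
Proof. by rewrite /P mulr_natl cosD2pi sinD2pi. Qed.

Lemma circle_pt2pi r : P r (2 * pi) = P r 0.
Proof. by rewrite -[RHS]circle_ptD2pi add0r. Qed.

Lemma cabs_le_sum z : cabs z <= `|complex.Re z| + `|complex.Im z|.
Proof.
rewrite cabsE -[leRHS]ger0_norm ?addr_ge0// -sqrtr_sqr ler_sqrt ?sqr_ge0//.
rewrite sqrrD !real_normK ?num_real// addrAC lerDl mulrn_wge0// mulr_ge0//.
Qed.

Lemma lipschitz_of_derive (f g : R -> R) : (forall x, is_derive x (1 : R) f (g x)) ->
  (forall x, `|g x| <= 1) -> forall x y, `|f x - f y| <= `|x - y|.
Proof.
move=> df g1 x y; wlog xy : x y / y <= x.
  move=> H; have [/H//|/ltW/H] := leP y x.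
  by rewrite distrC (distrC y).
have cf (z : R) : {for z, continuous f}.
  by apply: differentiable_continuous; exact/derivable1_diffP.
have [|c _ ->] := @MVT_segment R f g y x xy (fun c _ => df c).
  exact/cts_on_within/cts_onW.
by rewrite normrM ler_piMl.
Qed.

Lemma circle_pt_lipschitz r t x y : cabs (P r t - P x y) <= 2 * `|r - x| + 2 * `|x| * `|t - y|.
Proof.
apply: le_trans (cabs_le_sum _) _; rewrite !raddfB/=.
have cosl : `|cos t - cos y| <= `|t - y|.
  apply: (@lipschitz_of_derive cos (fun x => - sin x)) => z.
  by rewrite normrN ler_norml sin_geN1 sin_le1.
have sinl : `|sin t - sin y| <= `|t - y|.
  apply: (@lipschitz_of_derive sin cos) => z.
  by rewrite ler_norml cos_geN1 cos_le1.
have -> : r * cos t - x * cos y = (r - x) * cos t + x * (cos t - cos y) by ring.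
have -> : r * sin t - x * sin y = (r - x) * sin t + x * (sin t - sin y) by ring.
have c1 : `|(r - x) * cos t| <= `|r - x|.
  by rewrite normrM ler_piMr// ler_norml cos_geN1 cos_le1.
have s1 : `|(r - x) * sin t| <= `|r - x|.
  by rewrite normrM ler_piMr// ler_norml sin_geN1 sin_le1.
have c2 : `|x * (cos t - cos y)| <= `|x| * `|t - y|.
  by rewrite normrM ler_wpM2l.
have s2 : `|x * (sin t - sin y)| <= `|x| * `|t - y|.
  by rewrite normrM ler_wpM2l.
have := ler_normD ((r - x) * cos t) (x * (cos t - cos y)).
have := ler_normD ((r - x) * sin t) (x * (sin t - sin y)).
lra.
Qed.

Lemma continuous_circle_pt_radius t : continuous (fun r => P r t : R[i]^o).
Proof.
move=> r; have -> : (fun r => P r t : R[i]^o) =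
   (fun r => r%:C%C * (cos t +i* sin t)%C : R[i]^o).
  by apply/funext => s; rewrite /P; simpc.
by apply: cvgM; [exact: continuous_real_complex|exact: cvg_cst].
Qed.

Lemma continuous_circle_pt_angle r : continuous (fun t => P r t : R[i]^o).
Proof.
move=> t; have -> : (fun t => P r t : R[i]^o) =
   (fun t => r%:C%C * ((cos t)%:C%C + 'i%C * (sin t)%:C%C) : R[i]^o).
  by apply/funext => s; rewrite /P; simpc.
apply: cvgM; first exact: cvg_cst.
apply: cvgD.
  by apply: (@continuous_comp _ _ _ cos (real_complex R : R -> R[i]^o));
   [exact: continuous_cos|exact: continuous_real_complex].
apply: cvgM; first exact: cvg_cst.
by apply: (@continuous_comp _ _ _ sin (real_complex R : R -> R[i]^o));
   [exact: continuous_sin|exact: continuous_real_complex].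
Qed.
End Polar.

(** * Goursat's lemma on polar rectangles *)

Lemma ReM (R : realType) (z w : R[i]) : complex.Re (z * w) =
  complex.Re z * complex.Re w - complex.Im z * complex.Im w.
Proof. by case: z w => a b [c d]. Qed.

Lemma ImM (R : realType) (z w : R[i]) : complex.Im (z * w) =
  complex.Re z * complex.Im w + complex.Im z * complex.Re w.
Proof. by case: z w => a b [c d]. Qed.

Section Defect.
Context {R : realType} (D : R) (h : R[i] -> R[i]).
Hypothesis dh : forall z, cabs z < D -> derivable (h : R[i]^o -> R[i]^o) z 1.
Implicit Types (a b c d m r t x y e : R) (z w : R[i]) (phi : R[i]^o -> R).
Notation P := circle_pt.

Lemma continuous_radius phi r t : continuous phi -> `|r| < D ->
  {for r, continuous (fun r => phi (h (P r t)))}.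
Proof.
move=> cphi rD.
have ch : {for P r t, continuous (h : R[i]^o -> R[i]^o)}.
  by apply/holomorphic_continuous/dh; rewrite cabs_circle_pt.
have cP := @continuous_circle_pt_radius R t r.
have chP := @continuous_comp _ _ _ (fun r => P r t : R[i]^o) (h : R[i]^o -> R[i]^o) r cP ch.
exact: (@continuous_comp _ _ _ (fun r => h (P r t) : R[i]^o) phi r chP (cphi _)).
Qed.

Lemma continuous_angle phi r : continuous phi -> `|r| < D ->
  continuous (fun t => phi (h (P r t))).
Proof.
move=> cphi rD t.
have ch : {for P r t, continuous (h : R[i]^o -> R[i]^o)}.
  by apply/holomorphic_continuous/dh; rewrite cabs_circle_pt.
have cP := @continuous_circle_pt_angle R r t.
have chP := @continuous_comp _ _ _ (fun t => P r t : R[i]^o) (h : R[i]^o -> R[i]^o) t cP ch.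
exact: (@continuous_comp _ _ _ (fun t => h (P r t) : R[i]^o) phi t chP (cphi _)).
Qed.

Let u r t := complex.Re (h (P r t)).
Let v r t := complex.Im (h (P r t)).

(** The integral of the closed form [v / r dr + u dt] along the clockwise
    boundary of a polar rectangle, where [u] and [v] are the real and imaginary
    parts of [h]: this is the imaginary part of the integral of [h(z) dz / z]. *)
Definition defect a b c d :=
  segint a b (fun r => (v r d - v r c) * r^-1) - segint c d (fun t => u b t - u a t).

Lemma cts_inv a b : 0 < a -> cts_on a b (fun r => r^-1).
Proof.
move=> a0 x /andP[ax xb].
have -> : (fun r : R => r^-1) = GRing.inv by [].
apply: (@inv_continuous R x).
by rewrite gt_eqF// (lt_le_trans a0).
Qed.

Let cu r : `|r| < D -> continuous (u r).
Proof. by move=> ?; apply: (continuous_angle (@continuous_Re R)). Qed.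

Let cv a b c d : 0 < a -> b < D ->
  cts_on a b (fun r => (v r d - v r c) * r^-1).
Proof.
move=> a0 bD; apply: cts_onM; last exact: cts_inv.
have cvr r t : a <= r <= b -> {for r, continuous (v ^~ t)}.
  by move=> ?; apply: (@continuous_radius _ r t (@continuous_Im R)); rewrite gtr0_norm; lra.
by apply: cts_onB => r arb; exact: cvr.
Qed.

Lemma defect_split_r a m b c d : 0 < a -> a <= m -> m <= b -> b < D -> c <= d ->
  defect a b c d = defect a m c d + defect m b c d.
Proof.
move=> a0 am mb bD cd; rewrite /defect.
rewrite (@segint_split _ a m b)//; last exact: cv.
have nD r : a <= r -> r <= b -> `|r| < D by move=> *; rewrite gtr0_norm; lra.
have ca : continuous (u a) by apply/cu/nD; lra.
have cm : continuous (u m) by apply/cu/nD; lra.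
have cb : continuous (u b) by apply/cu/nD; lra.
rewrite !segintB; try exact: cts_onW.
by ring.
Qed.

Lemma defect_split_t a b c m d : 0 < a -> a <= b -> b < D -> c <= m -> m <= d ->
  defect a b c d = defect a b c m + defect a b m d.
Proof.
move=> a0 ab bD cm md; rewrite /defect.
have nD r : a <= r -> r <= b -> `|r| < D by move=> *; rewrite gtr0_norm; lra.
have ca : continuous (u a) by apply/cu/nD; lra.
have cb : continuous (u b) by apply/cu/nD; lra.
rewrite (@segint_split _ c m d)//; last by apply: cts_onB; exact: cts_onW.
rewrite (@eq_segint _ a b _ (fun r => (v r d - v r m) * r^-1 + (v r m - v r c) * r^-1)).
  by rewrite (segintD (@cv a b m d a0 bD) (@cv a b c m a0 bD)); ring.
by move=> r _; ring.
Qed.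

(** Near the point [x, y] replace [h] by its linear approximation [A]. The defect
    of [A] is exactly 0, because [Im (A(r, d) - A(r, c)) / r] does not depend on
    the radius, and the remainder is small compared with the diameter. *)
Lemma defect_small A B x y e : 0 < A -> A <= x <= B -> B < D -> 0 < e ->
  exists2 dl, 0 < dl & forall a b c d, A <= a -> a <= x <= b -> b <= B ->
       c <= y <= d -> b - a < dl -> d - c < dl ->
     `|defect a b c d| <= e * ((b - a) + (d - c)) ^+ 2.
Proof.
move=> A0 AxB BD e0.
have B0 : 0 < B by lra.
pose K := 2 * (1 + B) * (2 * (A^-1 + 1)).
have K0 : 0 < K by rewrite !mulr_gt0 ?addr_gt0 ?invr_gt0.
have hP : derivable (h : R[i]^o -> R[i]^o) (P x y) 1.
  by apply: dh; rewrite cabs_circle_pt gtr0_norm; lra.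
have [be be_exp] := complex_linear_approx hP.
have [dl dl0 hdl] := be_exp (e / K) (divr_gt0 e0 K0).
exists (dl / (4 * (1 + B))).
  by rewrite divr_gt0// mulr_gt0// addr_gt0.
move=> a b c d Aa axb bB cyd; rewrite !ltr_pdivlMr ?mulr_gt0 ?addr_gt0// => bal dcl.
have a0 : 0 < a by lra.
have bD : b < D by lra.
pose Rm z := h z - h (P x y) - be * (z - P x y).
set L := (b - a) + (d - c).
have L0 : 0 <= L by rewrite /L; lra.
(* A bound for the remainder [Rm] on the whole cell. *)
pose E := e / K * (2 * (1 + B) * L).
have RmE r t : a <= r <= b -> c <= t <= d -> cabs (Rm (P r t)) <= E.
  move=> arb ctd; have lip := @circle_pt_lipschitz R r t x y.
  have {}lip : cabs (P r t - P x y) <= 2 * (1 + B) * L.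
    apply: (le_trans lip).
    have rx : `|r - x| <= b - a by rewrite ler_norml; lra.
    have ty : `|t - y| <= d - c by rewrite ler_norml; lra.
    have xB : `|x| <= B by rewrite gtr0_norm; lra.
    have : `|x| * `|t - y| <= B * (d - c) by exact: ler_pM.
    have : 0 <= B * (b - a) by rewrite mulr_ge0//; lra.
    by rewrite /L; lra.
  have ltdl : cabs (P r t - P x y) < dl.
    apply: (le_lt_trans lip); rewrite /L; lra.
  apply: (le_trans (hdl _ ltdl)).
  by rewrite ler_wpM2l// divr_ge0// ltW.
have E0 : 0 <= E.
  by rewrite /E; apply: mulr_ge0; [rewrite divr_ge0// ltW|apply: mulr_ge0 => //; lra].
pose b1 := complex.Re be; pose b2 := complex.Im be.
(* The common value of the two sides for the linear approximation, up to the
   factor [b - a]. *)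
pose kap := b1 * (sin d - sin c) + b2 * (cos d - cos c).
have ReRm r t : complex.Re (Rm (P r t)) = u r t - complex.Re (h (P x y)) -
   (b1 * (r * cos t - x * cos y) - b2 * (r * sin t - x * sin y)).
  by rewrite /Rm !raddfB/= ReM !raddfB.
have ImRm r t : complex.Im (Rm (P r t)) = v r t - complex.Im (h (P x y)) -
   (b1 * (r * sin t - x * sin y) + b2 * (r * cos t - x * cos y)).
  by rewrite /Rm !raddfB/= ImM !raddfB.
have ImRm_r r : a <= r <= b -> (v r d - v r c) * r^-1 - kap =
    (complex.Im (Rm (P r d)) - complex.Im (Rm (P r c))) * r^-1.
  move=> arb; rewrite !ImRm /kap.
  have r0 : r != 0 by rewrite gt_eqF//; lra.
  by field.
pose Z t := (b - a) * (b1 * cos t - b2 * sin t).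
have ReRm_t t : u b t - u a t - Z t =
    complex.Re (Rm (P b t)) - complex.Re (Rm (P a t)).
  by rewrite /Z !ReRm; ring.
have cb : continuous (u b) by apply: cu; rewrite gtr0_norm; lra.
have ca : continuous (u a) by apply: cu; rewrite gtr0_norm; lra.
have cZ : continuous Z.
  move=> t; apply: cvgM; first exact: cvg_cst.
  apply: cvgB; apply: cvgM; try exact: cvg_cst.
    exact: continuous_cos.
  exact: continuous_sin.
have ab : a <= b by lra.
have cd : c <= d by lra.
have ZE : segint c d Z = kap * (b - a).
  have dZ (t : R) : is_derive t (1 : R)
      (fun t => (b - a) * (b1 * sin t + b2 * cos t)) (Z t).
    apply: is_derive_eq.
    by rewrite /Z /GRing.scale /=; ring.
  by rewrite (segint_FTC cd cZ dZ) /kap; ring.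
have c2 : cts_on c d (fun t => u b t - u a t) by apply: cts_onB; exact: cts_onW.
have -> : defect a b c d =
    segint a b (fun r => (v r d - v r c) * r^-1 - kap) -
    segint c d (fun t => u b t - u a t - Z t).
  rewrite (segintB (@cv a b c d a0 bD) (@cts_on_cst R a b kap)).
  rewrite (segintB c2 (@cts_onW R c d Z cZ)).
  by rewrite ZE segint_cst// /defect; ring.
have Re_E r t : a <= r <= b -> c <= t <= d -> `|complex.Re (Rm (P r t))| <= E.
  by move=> *; apply: le_trans (Re_le_cabs _) _; exact: RmE.
have Im_E r t : a <= r <= b -> c <= t <= d -> `|complex.Im (Rm (P r t))| <= E.
  by move=> *; apply: le_trans (Im_le_cabs _) _; exact: RmE.
have bound1 : `|segint a b (fun r => (v r d - v r c) * r^-1 - kap)| <= 2 * E * A^-1 * (b - a).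
  apply: segint_abs_le => //.
    exact: (cts_onB (@cv a b c d a0 bD) (@cts_on_cst R a b kap)).
  move=> r arb; rewrite ImRm_r// normrM; apply: ler_pM => //.
    apply: le_trans (ler_normB _ _) _.
    have := Im_E r d arb; have := Im_E r c arb; lra.
  have r0 : 0 < r by lra.
  by rewrite normfV gtr0_norm// lef_pV2 ?posrE//; lra.
have bound2 : `|segint c d (fun t => u b t - u a t - Z t)| <= 2 * E * (d - c).
  apply: segint_abs_le => //.
    exact: (cts_onB c2 (@cts_onW R c d Z cZ)).
  move=> t ctd; rewrite ReRm_t; apply: le_trans (ler_normB _ _) _.
  have := Re_E a t _ ctd; have := Re_E b t _ ctd; lra.
apply: le_trans (ler_normB _ _) _; apply: le_trans (lerD bound1 bound2) _.
have A10 : 0 < A^-1 by rewrite invr_gt0.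
have : 2 * E * A^-1 * (b - a) + 2 * E * (d - c) <= 2 * E * (A^-1 + 1) * L.
  have EA : 0 <= E * A^-1 by rewrite mulr_ge0// ltW.
  have t1 : 0 <= E * A^-1 * (d - c) by rewrite mulr_ge0//; lra.
  have t2 : 0 <= E * (b - a) by rewrite mulr_ge0//; lra.
  by rewrite /L; lra.
move/le_trans; apply; rewrite le_eqVlt; apply/orP; left; apply/eqP.
have A1 : A^-1 + 1 != 0 by rewrite gt_eqF// addr_gt0.
have B1 : 1 + B != 0 by rewrite gt_eqF// addr_gt0.
by rewrite /E /K; move: A1; generalize A^-1 => Ai A1; field; rewrite A1 B1.
Qed.
End Defect.

(** * The mean value property *)

Section MeanValue.
Context {R : realType} (D : R) (h : R[i] -> R[i]).
Hypothesis dh : forall z, cabs z < D -> derivable (h : R[i]^o -> R[i]^o) z 1.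
Implicit Types (a b c d m r t x y e : R).
Notation P := circle_pt.

(** The two radial sides of the rectangle of angles [[0, 2 * pi]] coincide, so
    that only the two circles contribute to the defect. *)
Lemma circle_integral_const a b : 0 < a -> a <= b -> b < D ->
  segint 0 (2 * pi) (fun t => complex.Re (h (P a t))) =
  segint 0 (2 * pi) (fun t => complex.Re (h (P b t))).
Proof.
move=> a0 ab bD.
have pi2 : (0 : R) <= 2 * pi by rewrite mulr_ge0// pi_ge0.
have : defect h a b 0 (2 * pi) = 0.
  apply: (@additive_rectangle_eq0 R (defect h) a b 0 (2 * pi)) => //.
  - move=> a' m b' c d aa am mb bb _ cd _.
    by apply: (defect_split_r dh) => //; lra.
  - move=> a' b' c m d aa ab' bb _ cm md _.
    by apply: (defect_split_t dh) => //; lra.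
  - move=> x y e axb cyd e0.
    have [dl dl0 H] := @defect_small R D h dh a b x y e a0 axb bD e0.
    by exists dl => // a' b' c d aa axb' bb _ cyd' _; exact: H.
rewrite /defect (@eq_segint _ a b _ (fun=> 0)); last first.
  by move=> r _; rewrite circle_pt2pi subrr mul0r.
rewrite segint_cst// mul0r sub0r => /eqP; rewrite oppr_eq0 segintB.
- by rewrite subr_eq0 => /eqP.
- by apply/cts_onW/(continuous_angle dh (@continuous_Re R)); rewrite gtr0_norm; lra.
- by apply/cts_onW/(continuous_angle dh (@continuous_Re R)); rewrite gtr0_norm; lra.
Qed.

(** By [circle_integral_const] the radius may be taken arbitrarily small, and
    then [h] is close to [h 0] on the circle. *)
Theorem mean_value b : 0 <= b < D ->
  segint 0 (2 * pi) (fun t => complex.Re (h (P b t))) = 2 * pi * complex.Re (h 0).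
Proof.
case/andP; rewrite le_eqVlt => /predU1P[<- D0|b0 bD].
  rewrite (@eq_segint _ _ _ _ (fun=> complex.Re (h 0))).
    by rewrite segint_cst ?mulr_ge0 ?pi_ge0//; ring.
  by move=> t _; rewrite /P !mul0r.
have pi2 : (0 : R) < 2 * pi by rewrite mulr_gt0// pi_gt0.
apply/eqP; rewrite -subr_eq0 -normr_eq0 eq_le normr_ge0 andbT.
apply/ler_addgt0Pr => e e0; rewrite add0r.
have d0 : derivable (h : R[i]^o -> R[i]^o) 0 1 by apply: dh; rewrite normc0; lra.
have [be /(_ 1 ltr01)[dl dl0 Hdl]] := complex_linear_approx d0.
set k := 1 + cabs be.
have k0 : 0 < k by rewrite /k ltr_wpDr// cabs_ge0.
have kp0 : 0 < k * (2 * pi) by rewrite mulr_gt0.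
pose a := Num.min b (Num.min (dl / 2) (e / (k * (2 * pi)))).
have a0 : 0 < a by rewrite !lt_min b0 !divr_gt0.
have ab : a <= b by rewrite ge_min lexx.
have adl : a < dl by rewrite !gt_min (_ : dl / 2 < dl) ?orbT//; lra.
have ae : a * (k * (2 * pi)) <= e.
  by rewrite -ler_pdivlMr// !ge_min lexx !orbT.
have aD : `|a| < D by rewrite gtr0_norm//; lra.
have cu : cts_on 0 (2 * pi) (fun t => complex.Re (h (P a t))).
  exact/cts_onW/(continuous_angle dh (@continuous_Re R)).
rewrite -(circle_integral_const a0 ab bD).
have -> : 2 * pi * complex.Re (h 0) = segint 0 (2 * pi) (fun=> complex.Re (h 0)).
  by rewrite segint_cst ?ltW//; ring.
rewrite -(segintB cu (@cts_on_cst R _ _ _)).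
apply: le_trans ae; have -> : a * (k * (2 * pi)) = a * k * (2 * pi - 0) by ring.
apply: segint_abs_le.
- exact: ltW.
- exact: (cts_onB cu (@cts_on_cst R _ _ _)).
move=> t _; rewrite -raddfB; apply: le_trans (Re_le_cabs _) _.
have ca : cabs (P a t) = a by rewrite cabs_circle_pt gtr0_norm.
have := Hdl (P a t); rewrite subr0 ca mul1r => /(_ adl) Ha.
have -> : h (P a t) - h 0 = (h (P a t) - h 0 - be * P a t) + be * P a t by rewrite subrK.
apply: le_trans (cabsD _ _) _; rewrite normcM ca /k.
by rewrite mulrDr mulr1 (mulrC a) lerD2r.
Qed.
End MeanValue.

(** * Inequalities between real powers *)

Section RealIneq.
Context {R : realType}.
Implicit Types (a b c d e m p q r s t x y : R).

(** Young's inequality for the product of [t] and 1, with exponent [p]. *)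
Lemma powR_ge_bernoulli p t : 1 < p -> 0 <= t -> 1 + p * (t - 1) <= t `^ p.
Proof.
move=> p1 t0; have p0 : 0 < p by lra.
have q0 : 0 < p / (p - 1) by rewrite divr_gt0; lra.
have pq : p^-1 + (p / (p - 1))^-1 = 1.
  by rewrite invf_div; field; rewrite !gt_eqF; lra.
have := @conjugate_powR R t 1 p _ t0 ler01 p0 q0 pq.
rewrite powR1 mul1r mulr1 => H.
have e1 : (p / (p - 1))^-1 = 1 - p^-1 by lra.
move: H; rewrite e1 -(ler_pM2r p0) mulrDl mulrBl divfK ?gt_eqF// mulVf ?gt_eqF//.
lra.
Qed.

Lemma powR_ge_tangent p m t : 1 < p -> 0 < m -> 0 <= t ->
  m `^ p + p * m `^ (p - 1) * (t - m) <= t `^ p.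
Proof.
move=> p1 m0 t0.
have := powR_ge_bernoulli p1 (divr_ge0 t0 (ltW m0)).
have mp : 0 < m `^ p by rewrite powR_gt0.
rewrite -(ler_pM2r mp) -(powRM p (divr_ge0 t0 (ltW m0)) (ltW m0)) divfK ?gt_eqF//.
apply: le_trans; rewrite le_eqVlt; apply/orP; left; apply/eqP.
rewrite -[in LHS](@mulr_powRB1 _ m p) ?ltW//; last lra.
rewrite -[in RHS](@mulr_powRB1 _ m p) ?ltW//; last lra.
by field; rewrite gt_eqF.
Qed.

(** The case [s < 1] is [powR_ge_tangent] for the inverse function, whose
    exponent is [s^-1]. *)
Lemma powR_le_tangent s m t : 0 < s -> s <= 1 -> 0 < m -> 0 <= t ->
  t `^ s <= m `^ s + s * m `^ (s - 1) * (t - m).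
Proof.
move=> s0; rewrite le_eqVlt => /predU1P[-> m0 t0|s1 m0 t0].
  by rewrite subrr powRr0 (powRr1 t0) (powRr1 (ltW m0)) !mul1r subrKC.
have p1 : 1 < s^-1 by rewrite invf_gt1.
have ms : 0 < m `^ s by rewrite powR_gt0.
have := powR_ge_tangent p1 ms (powR_ge0 t s).
rewrite -!powRrM mulfV ?gt_eqF// (powRr1 t0) (powRr1 (ltW m0)).
have -> : s * (s^-1 - 1) = 1 - s by field; rewrite gt_eqF.
move=> H.
have m1 : 0 < m `^ (s - 1) by rewrite powR_gt0.
have m1E : m `^ (1 - s) * m `^ (s - 1) = 1.
  rewrite -powRD; last by apply/implyP => _; rewrite gt_eqF.
  have -> : 1 - s + (s - 1) = 0 by ring.
  exact: powRr0.
have {}H : s^-1 * m `^ (1 - s) * (t `^ s - m `^ s) <= t - m by lra.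
have sm : 0 < s * m `^ (s - 1) by rewrite mulr_gt0.
have := ler_wpM2l (ltW sm) H.
have -> : s * m `^ (s - 1) * (s^-1 * m `^ (1 - s) * (t `^ s - m `^ s)) =
   (m `^ (1 - s) * m `^ (s - 1)) * (t `^ s - m `^ s) by field; rewrite gt_eqF.
by rewrite m1E; lra.
Qed.

Lemma powR_concave s l x y : 0 < s -> s <= 1 -> 0 <= l -> l <= 1 -> 0 <= x -> 0 <= y ->
  l * x `^ s + (1 - l) * y `^ s <= (l * x + (1 - l) * y) `^ s.
Proof.
move=> s0 s1 l0 l1 x0 y0; set m := l * x + (1 - l) * y.
have l1' : 0 <= 1 - l by lra.
have lx : 0 <= l * x by rewrite mulr_ge0.
have ly : 0 <= (1 - l) * y by rewrite mulr_ge0.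
have [m0|m0] := ltrP 0 m.
  have := ler_wpM2l l0 (powR_le_tangent s0 s1 m0 x0).
  have := ler_wpM2l l1' (powR_le_tangent s0 s1 m0 y0).
  have : l * (x - m) + (1 - l) * (y - m) = 0 by rewrite /m; ring.
  move=> /(congr1 (fun z => s * m `^ (s - 1) * z)); rewrite mulr0.
  lra.
have lx0 : l * x = 0 by rewrite /m in m0; lra.
have ly0 : (1 - l) * y = 0 by rewrite /m in m0; lra.
have z k w : k * w = 0 -> k * w `^ s = 0.
  move/eqP; rewrite mulf_eq0 => /orP[/eqP ->|/eqP ->]; first by rewrite mul0r.
  by rewrite powR0 ?mulr0// gt_eqF.
by rewrite !z// addr0 powR_ge0.
Qed.

Lemma powR_convex_half s x y : 1 < s -> 0 <= x -> 0 <= y ->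
  ((x + y) / 2) `^ s <= (x `^ s + y `^ s) / 2.
Proof.
move=> s1 x0 y0; set m := (x + y) / 2.
have [m0|m0] := ltrP 0 m.
  have := powR_ge_tangent s1 m0 x0; have := powR_ge_tangent s1 m0 y0.
  have : (x - m) + (y - m) = 0 by rewrite /m; field.
  move=> /(congr1 (fun z => s * m `^ (s - 1) * z)); rewrite mulr0.
  lra.
have -> : m = 0 by move: m0; rewrite /m; lra.
have s0 : s != 0 by rewrite gt_eqF; lra.
by rewrite (powR0 s0) divr_ge0// addr_ge0 ?powR_ge0.
Qed.

Lemma powR_superadditive s x y : 1 < s -> 0 <= x -> 0 <= y ->
  x `^ s + y `^ s <= (x + y) `^ s.
Proof.
move=> s1 x0 y0; have s0 : 0 < s by lra.
rewrite -!(mulr_powRB1 _ s0) ?addr_ge0// mulrDl.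
have s10 : 0 <= s - 1 by lra.
have xy0 : 0 <= x + y by lra.
apply: lerD; apply: ler_wpM2l => //; apply: ge0_ler_powR => //.
  by rewrite lerDl.
by rewrite lerDr.
Qed.

Lemma powR_neg_ge_tangent e x : e <= 0 -> 0 < x -> 1 + e * (x - 1) <= x `^ e.
Proof.
move=> e0 x0; rewrite /powR gt_eqF//; apply: le_trans (expR_ge1Dx _).
rewrite lerD2l ler_wnM2l//.
have := @le_ln1Dx R (x - 1); rewrite subrKC; apply; lra.
Qed.

(** Both sides and their first derivatives agree at 0, and the second derivative
    of the right-hand side is at least the constant one on the left, because
    [x^(p-2)] lies above its tangent at 1. The argument integrates twice, that
    is, uses the mean value theorem twice. *)
Lemma two_point_unit p s : 1 < p -> p <= 2 -> 0 <= s -> s <= 1 ->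
  1 + p * (p - 1) / 2 * s ^+ 2 <= ((1 + s) `^ p + (1 - s) `^ p) / 2.
Proof.
move=> p1 p2 s0 s1; have p0 : 0 < p by lra.
have d1 (k x : R) : 0 < 1 + x ->
    is_derive x (1 : R) (fun x => (1 + x) `^ k) (k * (1 + x) `^ (k - 1)).
  move=> x0.
  have dk : is_derive (1 + x) (1 : R) (fun x => x `^ k) (k * (1 + x) `^ (k - 1)).
    exact: is_derive1_powR.
  have dx : is_derive x (1 : R) (fun x => 1 + x) 1.
    by apply: is_derive_eq; ring.
  by have := @is_derive1_comp R (fun x => x `^ k) (fun x => 1 + x) x _ _ dk dx; rewrite mulr1.
have d2 (k x : R) : 0 < 1 - x ->
    is_derive x (1 : R) (fun x => (1 - x) `^ k) (- (k * (1 - x) `^ (k - 1))).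
  move=> x0.
  have dk : is_derive (1 - x) (1 : R) (fun x => x `^ k) (k * (1 - x) `^ (k - 1)).
    exact: is_derive1_powR.
  have dx : is_derive x (1 : R) (fun x => 1 - x) (- 1).
    by apply: is_derive_eq; ring.
  by have := @is_derive1_comp R (fun x => x `^ k) (fun x => 1 - x) x _ _ dk dx; rewrite mulrN1.
have g0 c : 0 < c -> c < 1 -> 2 * (p - 1) * c <= (1 + c) `^ (p - 1) - (1 - c) `^ (p - 1).
  move=> c0 c1.
  pose g x := (1 + x) `^ (p - 1) - (1 - x) `^ (p - 1) - 2 * (p - 1) * x.
  pose g' x := (p - 1) * (1 + x) `^ (p - 1 - 1) + (p - 1) * (1 - x) `^ (p - 1 - 1) -
     2 * (p - 1).
  have dg (x : R) : 0 <= x <= c -> is_derive x (1 : R) g (g' x).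
    move=> xc; have x1 : 0 < 1 + x by lra. have x2 : 0 < 1 - x by lra.
    have := d1 (p - 1) x x1; have := d2 (p - 1) x x2 => D1 D2.
    apply: is_derive_eq; rewrite /g' /GRing.scale /=; ring.
  have cg : {within `[0, c], continuous g}.
    apply: cts_on_within => x xc; apply: differentiable_continuous.
    by apply/derivable1_diffP; have := dg x xc; case.
  have dg' (x : R) : x \in `]0, c[ -> is_derive x (1 : R) g (g' x).
    by rewrite in_itv/= => xc; apply: dg; lra.
  have [x /[!in_itv]/= xc gE] := MVT c0 dg' cg.
  have x1 : 0 < 1 + x by lra. have x2 : 0 < 1 - x by lra.
  have e0 : p - 1 - 1 <= 0 by lra.
  have := powR_neg_ge_tangent e0 x1; have := powR_neg_ge_tangent e0 x2 => T1 T2.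
  have : 0 <= g' x * (c - 0).
    rewrite mulr_ge0//; last lra.
    have : 2 <= (1 + x) `^ (p - 1 - 1) + (1 - x) `^ (p - 1 - 1) by lra.
    have q0 : 0 <= p - 1 by lra.
    by move=> /(ler_wpM2l q0); rewrite /g'; lra.
  by rewrite -gE /g !addr0 !subr0 powR1; lra.
have [->|sN0] := eqVneq s 0.
  by rewrite expr0n mulr0 !addr0 subr0 powR1; lra.
have s_gt0 : 0 < s by rewrite lt_neqAle eq_sym sN0.
pose F x := ((1 + x) `^ p + (1 - x) `^ p) / 2 - p * (p - 1) / 2 * x ^+ 2.
pose F' x := p / 2 * ((1 + x) `^ (p - 1) - (1 - x) `^ (p - 1)) - p * (p - 1) * x.
have dF (x : R) : x \in `]0, s[ -> is_derive x (1 : R) F (F' x).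
  rewrite in_itv/= => xs; have x1 : 0 < 1 + x by lra. have x2 : 0 < 1 - x by lra.
  have := d1 p x x1; have := d2 p x x2 => D1 D2.
  by apply: is_derive_eq; rewrite /F' /GRing.scale /=; field.
pose G x := (`|1 + x| `^ p + `|1 - x| `^ p) / 2 - p * (p - 1) / 2 * x ^+ 2.
have cG : continuous G.
  have c1 : continuous (fun x : R => `|1 + x| `^ p).
    move=> x; apply: (@continuous_comp _ _ _ (fun x : R => 1 + x) (fun x => `|x| `^ p)).
      by apply: cvgD; [exact: cvg_cst|exact: cvg_id].
    exact: continuous_abs_powR.
  have c2 : continuous (fun x : R => `|1 - x| `^ p).
    move=> x; apply: (@continuous_comp _ _ _ (fun x : R => 1 - x) (fun x => `|x| `^ p)).
      by apply: cvgB; [exact: cvg_cst|exact: cvg_id].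
    exact: continuous_abs_powR.
  move=> x; apply: cvgB.
    by apply: cvgM; [apply: cvgD; [exact: c1|exact: c2]|exact: cvg_cst].
  by apply: cvgM; [exact: cvg_cst|apply: cvgM; exact: cvg_id].
have cF : {within `[0, s], continuous F}.
  apply: (@subspace_eq_continuous _ _ _ G); last first.
    exact/cts_on_within/cts_onW.
  move=> x; rewrite inE/= in_itv/= => xs; rewrite /F /G !ger0_norm//; lra.
have [x /[!in_itv]/= xs FE] := MVT s_gt0 dF cF.
have : 0 <= F' x * (s - 0).
  rewrite mulr_ge0//; last lra.
  have x0 : 0 < x by lra. have x1 : x < 1 by lra.
  have p20 : 0 <= p / 2 by lra.
  by have := ler_wpM2l p20 (g0 x x0 x1); rewrite /F'; lra.
by rewrite -FE /F expr0n mulr0 !addr0 !subr0 powR1; lra.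
Qed.
End RealIneq.

(** * Two-point inequalities in the complex plane *)

Section ComplexIneq.
Context {R : realType}.
Implicit Types (c d e m p q r s x y : R) (a b z w : R[i]).

Lemma powR_sq p x : 0 <= x -> (x ^+ 2) `^ (p / 2) = x `^ p.
Proof. by move=> x0; rewrite -powR_mulrn// -powRrM; congr (_ `^ _); field. Qed.

(** Dividing by [x] reduces to [two_point_unit], since Bernoulli's inequality for
    the exponent [p / 2 <= 1] bounds the left-hand side. *)
Lemma two_point_ordered p x y : 1 < p -> p <= 2 -> 0 <= y -> y <= x ->
  (x ^+ 2 + (p - 1) * y ^+ 2) `^ (p / 2) <= ((x + y) `^ p + (x - y) `^ p) / 2.
Proof.
move=> p1 p2 y0 yx.
have p0 : 0 < p by lra.
have [x0|x0] := eqVneq x 0.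
  have -> : y = 0 by lra.
  by rewrite x0 !expr0n mulr0 !addr0 subr0 !powR0 ?gt_eqF ?divr_gt0// addr0 mul0r.
have {}x0 : 0 < x by lra.
pose s := y / x.
have s0 : 0 <= s by rewrite divr_ge0// ltW.
have s1 : s <= 1 by rewrite ler_pdivrMr ?mul1r.
have yE : y = x * s by rewrite /s; field; rewrite gt_eqF.
have -> : x ^+ 2 + (p - 1) * y ^+ 2 = x ^+ 2 * (1 + (p - 1) * s ^+ 2) by rewrite yE; ring.
have -> : x + y = x * (1 + s) by rewrite yE; ring.
have -> : x - y = x * (1 - s) by rewrite yE; ring.
have q0 : 0 <= (p - 1) * s ^+ 2 by rewrite mulr_ge0 ?sqr_ge0//; lra.
have x0' := ltW x0.
have q1 : 0 <= 1 + (p - 1) * s ^+ 2 by lra.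
have s1p : 0 <= 1 + s by lra. have s1m : 0 <= 1 - s by lra.
rewrite (powRM _ (sqr_ge0 x) q1) (powRM _ x0' s1p) (powRM _ x0' s1m) powR_sq//.
rewrite -mulrDr -mulrA ler_pM2l ?powR_gt0//.
apply: le_trans (two_point_unit p1 p2 s0 s1).
have := @powR_le_tangent R (p / 2) 1 (1 + (p - 1) * s ^+ 2).
rewrite !powR1 mulr1 addrAC subrr add0r => H.
by apply: (le_trans (H _ _ _ _)); lra.
Qed.

(** When [x < y] the roles are exchanged, which only increases the left-hand
    side of the ordered inequality as [p - 1 <= 1]. *)
Lemma two_point_real p x y : 1 < p -> p <= 2 -> 0 <= x -> 0 <= y ->
  (x ^+ 2 + (p - 1) * y ^+ 2) `^ (p / 2) <= ((x + y) `^ p + `|x - y| `^ p) / 2.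
Proof.
move=> p1 p2 x0 y0; have [yx|xy] := leP y x.
  by rewrite ger0_norm ?subr_ge0// two_point_ordered.
rewrite ltr0_norm ?subr_lt0// opprB addrC [in leRHS](addrC x) addrC.
apply: le_trans (two_point_ordered p1 p2 x0 (ltW xy)).
apply: ge0_ler_powR; rewrite ?nnegrE; [lra| | |].
- by rewrite addr_ge0 ?sqr_ge0// mulr_ge0 ?sqr_ge0//; lra.
- by rewrite addr_ge0 ?sqr_ge0// mulr_ge0 ?sqr_ge0//; lra.
have xy2 : x ^+ 2 <= y ^+ 2 by rewrite ler_sqr ?nnegrE// ltW.
have : 0 <= (2 - p) * (y ^+ 2 - x ^+ 2) by rewrite mulr_ge0//; lra.
lra.
Qed.

Lemma cabs_sq z : cabs z ^+ 2 = complex.Re z ^+ 2 + complex.Im z ^+ 2.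
Proof. by rewrite cabsE sqr_sqrtr// addr_ge0 ?sqr_ge0. Qed.

(** The real part of [z] times the conjugate of [w]. *)
Definition re_dot z w := complex.Re z * complex.Re w + complex.Im z * complex.Im w.

Lemma cabs_sqD z w : cabs (z + w) ^+ 2 = cabs z ^+ 2 + cabs w ^+ 2 + 2 * re_dot z w.
Proof. by rewrite !cabs_sq !raddfD/= /re_dot; ring. Qed.

Lemma cabs_sqB z w : cabs (z - w) ^+ 2 = cabs z ^+ 2 + cabs w ^+ 2 - 2 * re_dot z w.
Proof. by rewrite !cabs_sq !raddfB/= /re_dot; ring. Qed.

Lemma re_dot_le z w : `|re_dot z w| <= cabs z * cabs w.
Proof.
rewrite -ler_sqr ?nnegrE ?mulr_ge0 ?cabs_ge0// real_normK ?num_real// exprMn.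
rewrite !cabs_sq /re_dot -subr_ge0.
set x := complex.Re z; set y := complex.Im z; set u := complex.Re w; set v := complex.Im w.
suff -> : (x ^+ 2 + y ^+ 2) * (u ^+ 2 + v ^+ 2) - (x * u + y * v) ^+ 2 = (x * v - y * u) ^+ 2.
  exact: sqr_ge0.
by ring.
Qed.

(** The sum [(s + c)^(p/2) + (s - c)^(p/2)], with [s = |a|^2 + |b|^2] and
    [c = 2 re_dot a b], is concave and even in [c], so it is least when
    [|c|] has its largest value [2 |a| |b|]; this is the case of nonnegative
    reals. *)
Lemma two_point_complex p a b : 1 < p -> p <= 2 ->
  (cabs a ^+ 2 + (p - 1) * cabs b ^+ 2) `^ (p / 2) <=
  (cabs (a + b) `^ p + cabs (a - b) `^ p) / 2.
Proof.
move=> p1 p2; have := two_point_real p1 p2 (cabs_ge0 a) (cabs_ge0 b).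
move/le_trans; apply.
rewrite -[X in X <= _ / _]mulrC -[leRHS]mulrC ler_pM2l ?invr_gt0//.
rewrite -(powR_sq p (cabs_ge0 (a + b))) -(powR_sq p (cabs_ge0 (a - b))).
have A0 := cabs_ge0 a; have B0 := cabs_ge0 b.
rewrite -(powR_sq p (addr_ge0 A0 B0)) -(powR_sq p (normr_ge0 _)) real_normK ?num_real//.
rewrite cabs_sqD cabs_sqB.
have := re_dot_le a b; set c := re_dot a b; set A := cabs a; set B := cabs b => cAB.
have -> : (A + B) ^+ 2 = A ^+ 2 + B ^+ 2 + 2 * (A * B) by ring.
have -> : (A - B) ^+ 2 = A ^+ 2 + B ^+ 2 - 2 * (A * B) by ring.
have S0 : 0 <= A ^+ 2 + B ^+ 2 - 2 * (A * B).
  by rewrite (_ : _ - _ = (A - B) ^+ 2) ?sqr_ge0//; ring.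
move: S0 cAB; set S := A ^+ 2 + B ^+ 2; set M := A * B => S0 cM.
have M0 : 0 <= M by rewrite mulr_ge0.
have [M_0|MN0] := eqVneq M 0.
  have -> : c = M by apply/eqP; rewrite M_0 -normr_le0 -M_0.
  by [].
have {MN0} Mgt0 : 0 < M by lra.
pose l := (1 + c / M) / 2.
have lE : c = (2 * l - 1) * M by rewrite /l; field; rewrite gt_eqF.
have /andP[cM1 cM2] : - M <= c <= M by rewrite -ler_norml.
have l0 : 0 <= l.
  by rewrite /l divr_ge0//; rewrite -(ler_pM2r Mgt0) mul0r mulrDl divfK ?gt_eqF//; lra.
have l1 : l <= 1.
  by rewrite /l ler_pdivrMr// -(ler_pM2r Mgt0) mulrDl divfK ?gt_eqF//; lra.
have e0 : 0 < p / 2 by lra. have e1 : p / 2 <= 1 by lra.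
have S1 : 0 <= S + 2 * M by lra.
have l0' : 0 <= 1 - l by lra. have l1' : 1 - l <= 1 by lra.
have := powR_concave e0 e1 l0 l1 S1 S0.
have := powR_concave e0 e1 l0' l1' S1 S0.
have -> : l * (S + 2 * M) + (1 - l) * (S - 2 * M) = S + 2 * c by rewrite lE; ring.
have -> : (1 - l) * (S + 2 * M) + (1 - (1 - l)) * (S - 2 * M) = S - 2 * c by rewrite lE; ring.
lra.
Qed.

(** The squares of [|a + b|] and [|a - b|] have sum [2 (|a|^2 + |b|^2)]; the power
    [p / 2 > 1] is superadditive and convex. *)
Lemma clarkson_complex p a b : 2 < p ->
  cabs (a + b) `^ p + cabs (a - b) `^ p <=
  2 `^ (p - 1) * (cabs a `^ p + cabs b `^ p).
Proof.
move=> p2; have e1 : 1 < p / 2 by lra.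
rewrite -!(powR_sq p (cabs_ge0 _)).
have sq0 z : 0 <= cabs z ^+ 2 by rewrite sqr_ge0.
apply: le_trans (powR_superadditive e1 (sq0 _) (sq0 _)) _.
have -> : cabs (a + b) ^+ 2 + cabs (a - b) ^+ 2 =
    2 ^+ 2 * ((cabs a ^+ 2 + cabs b ^+ 2) / 2).
  by rewrite cabs_sqD cabs_sqB; field.
have h0 : 0 <= (cabs a ^+ 2 + cabs b ^+ 2) / 2 by rewrite divr_ge0// addr_ge0.
rewrite (powRM _ (sqr_ge0 2) h0) (powR_sq p (ler0n R 2)).
have -> : 2 `^ (p - 1) = 2 `^ p / 2.
  rewrite -(@mulr_powRB1 _ 2 p)//; last lra.
  by field.
rewrite -mulrA ler_pM2l ?powR_gt0//.
have := powR_convex_half e1 (sq0 a) (sq0 b); lra.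
Qed.

(** Multiplying the n-th inequality by [2 ^ n] makes the sum telescope; what
    remains is a geometric series of ratio [s]. *)
Lemma halving_iteration (d : nat -> R) s c : 0 < s -> s < 1 ->
  (forall n, 0 <= d n) ->
  (forall n, 2 * d n.+1 + c * (s / 2) ^+ n <= d n) -> c / (1 - s) <= d 0%N.
Proof.
move=> s0 s1 d0 dS.
have partial n : 2 ^+ n * d n + c * (1 - s ^+ n) / (1 - s) <= d 0%N.
  have s1N : 1 - s != 0 by rewrite gt_eqF// subr_gt0.
  elim: n => [|n IH]; first by rewrite !expr0 subrr mulr0 mul0r addr0 mul1r.
  apply: le_trans IH.
  have two0 : (0 : R) <= 2 ^+ n by rewrite exprn_ge0.
  have := ler_wpM2l two0 (dS n).
  have -> : 2 ^+ n * (2 * d n.+1 + c * (s / 2) ^+ n) = 2 ^+ n.+1 * d n.+1 + c * s ^+ n.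
    by rewrite expr_div_n exprS; field; rewrite expf_neq0.
  suff -> : c * (1 - s ^+ n.+1) / (1 - s) = c * s ^+ n + c * (1 - s ^+ n) / (1 - s) by lra.
  by rewrite exprS; field.
have lim : (fun n => c * (1 - s ^+ n) / (1 - s)) @ \oo --> c * (1 - 0) / (1 - s).
  apply: cvgM; last exact: cvg_cst.
  apply: cvgM; first exact: cvg_cst.
  apply: cvgB; first exact: cvg_cst.
  by apply: cvg_expr; rewrite ger0_norm// ltW.
rewrite subr0 mulr1 in lim.
apply: (cvgr_to_le lim); apply: nearW => n; apply: le_trans (partial n).
by rewrite lerDr mulr_ge0// exprn_ge0.
Qed.
End ComplexIneq.

(** * Parallelogram inequalities for the p-norm on a circle *)

Section CircleNorm.
Context {R : realType}.
Implicit Types (c e k m p r s x y : R) (f g : R -> R) (u v : R -> R[i]).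

Definition average f := (2 * pi)^-1 * segint 0 (2 * pi) f.

Lemma pi2_gt0 : (0 : R) < 2 * pi.
Proof. by rewrite mulr_gt0// pi_gt0. Qed.

Lemma pi2V_ge0 : (0 : R) <= (2 * pi)^-1.
Proof. by rewrite invr_ge0 ltW// pi2_gt0. Qed.

Lemma averageD f g : continuous f -> continuous g ->
  average (fun x => f x + g x) = average f + average g.
Proof. by move=> cf cg; rewrite /average segintD ?mulrDr//; exact: cts_onW. Qed.

Lemma averageZ k f : continuous f -> average (fun x => k * f x) = k * average f.
Proof. by move=> cf; rewrite /average segintZ; [rewrite mulrCA|exact: cts_onW]. Qed.

Lemma average_cst k : average (fun=> k) = k.
Proof.
rewrite /average segint_cst; last exact/ltW/pi2_gt0.
by rewrite subr0 mulrCA mulVf ?mulr1// gt_eqF// pi2_gt0.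
Qed.

Lemma le_average f g : continuous f -> continuous g -> (forall x, f x <= g x) ->
  average f <= average g.
Proof.
move=> cf cg fg; rewrite /average ler_wpM2l ?pi2V_ge0//.
by apply: segint_le => //; exact: cts_onW.
Qed.

Lemma average_ge0 f : (forall x, 0 <= f x) -> 0 <= average f.
Proof.
by move=> f0; rewrite /average mulr_ge0 ?pi2V_ge0//; apply: Rintegral_ge0.
Qed.

Lemma eq_average f g : f =1 g -> average f = average g.
Proof. by move=> fg; rewrite /average (eq_segint (g := g)). Qed.

Lemma cts_add f g : continuous f -> continuous g -> continuous (fun x => f x + g x).
Proof. by move=> cf cg x; apply: cvgD; [exact: cf|exact: cg]. Qed.

Lemma cts_scale k f : continuous f -> continuous (fun x => k * f x).
Proof. by move=> cf x; apply: cvgM; [exact: cvg_cst|exact: cf]. Qed.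

Lemma continuous_powR e f : 0 < e -> (forall x, 0 <= f x) -> continuous f ->
  continuous (fun x => f x `^ e).
Proof.
move=> e0 f0 cf.
have -> : (fun x => f x `^ e) = (fun x => `|f x| `^ e).
  by apply/funext => x; rewrite ger0_norm.
move=> x; apply: (@continuous_comp _ _ _ f (fun y => `|y| `^ e)); first exact: cf.
exact: continuous_abs_powR.
Qed.

(** For [A, B > 0], concavity bounds [(f + g)^e] below by the combination of
    [(f / A)^e] and [(g / B)^e] with weights [A / (A + B)] and [B / (A + B)], up to
    the factor [(A + B)^e]; both powers have average 1. Passing [A] and [B] through
    their e-th powers avoids the exponent [e^-1]. *)
Lemma reverse_minkowski e f g A B : 0 < e -> e <= 1 ->
  continuous f -> continuous g -> (forall x, 0 <= f x) -> (forall x, 0 <= g x) ->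
  0 <= A -> 0 <= B -> A `^ e = average (fun x => f x `^ e) ->
  B `^ e = average (fun x => g x `^ e) ->
  (A + B) `^ e <= average (fun x => (f x + g x) `^ e).
Proof.
move=> e0 e1 cf cg f0 g0 A0 B0 AE BE.
have cfe := continuous_powR e0 f0 cf; have cge := continuous_powR e0 g0 cg.
have fg0 x : 0 <= f x + g x by rewrite addr_ge0.
have cfge := continuous_powR e0 fg0 (cts_add cf cg).
have [A_0|AN0] := eqVneq A 0.
  rewrite A_0 add0r BE; apply: le_average => // x.
  by apply: ge0_ler_powR; rewrite ?nnegrE ?(ltW e0)// lerDr.
have [B_0|BN0] := eqVneq B 0.
  rewrite B_0 addr0 AE; apply: le_average => // x.
  by apply: ge0_ler_powR; rewrite ?nnegrE ?(ltW e0)// lerDl.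
have A_gt0 : 0 < A by rewrite lt_neqAle eq_sym AN0.
have B_gt0 : 0 < B by rewrite lt_neqAle eq_sym BN0.
set S := A + B; have S0 : 0 < S by rewrite addr_gt0.
have Ae0 : A `^ e != 0 by rewrite gt_eqF// powR_gt0.
have Be0 : B `^ e != 0 by rewrite gt_eqF// powR_gt0.
pose ka := S `^ e * (A / S) / A `^ e; pose kb := S `^ e * (B / S) / B `^ e.
have -> : S `^ e = average (fun x => ka * f x `^ e + kb * g x `^ e).
  rewrite averageD; [|exact: cts_scale..].
  rewrite !averageZ// -AE -BE /ka /kb !divfK//.
  by rewrite /S; field; rewrite gt_eqF.
apply: le_average => //; first by apply: cts_add; exact: cts_scale.
move=> x; have l0 : 0 <= A / S by rewrite divr_ge0// ltW.
have l1 : A / S <= 1 by rewrite ler_pdivrMr// mul1r /S lerDl.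
have fA : 0 <= f x / A by rewrite divr_ge0.
have gB : 0 <= g x / B by rewrite divr_ge0.
have := ler_wpM2l (powR_ge0 S e) (powR_concave e0 e1 l0 l1 fA gB).
have h0 : 0 <= A / S * (f x / A) + (1 - A / S) * (g x / B).
  by apply: addr_ge0; apply: mulr_ge0 => //; rewrite subr_ge0.
rewrite -(powRM e (ltW S0) h0).
have -> : S * (A / S * (f x / A) + (1 - A / S) * (g x / B)) = f x + g x.
  by rewrite /S; field; rewrite AN0 BN0 gt_eqF.
apply: le_trans; rewrite le_eqVlt; apply/orP; left; apply/eqP.
have powRdiv y z : 0 <= y -> 0 < z -> (y / z) `^ e = y `^ e / z `^ e.
  move=> y0 z0; rewrite powRM ?invr_ge0 ?(ltW z0)//.
  by rewrite -(powR_inv1 (ltW z0)) -powRrM mulN1r powRN.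
rewrite !powRdiv// /ka /kb.
have -> : 1 - A / S = B / S by rewrite /S; field; rewrite gt_eqF.
by ring.
Qed.

Definition lp_norm p u := average (fun t => cabs (u t) `^ p) `^ p^-1.

Definition ccontinuous u := continuous (u : R -> R[i]^o).

Lemma ccontinuousD u v : ccontinuous u -> ccontinuous v -> ccontinuous (fun t => u t + v t).
Proof. by move=> cu cv t; apply: (@cvgD _ R[i]^o); [exact: cu|exact: cv]. Qed.

Lemma ccontinuousB u v : ccontinuous u -> ccontinuous v -> ccontinuous (fun t => u t - v t).
Proof. by move=> cu cv t; apply: (@cvgB _ R[i]^o); [exact: cu|exact: cv]. Qed.

Lemma continuous_ccabs u : ccontinuous u -> continuous (fun t => cabs (u t)).
Proof.
move=> cu t; apply: (@continuous_comp _ _ _ (u : R -> R[i]^o) (fun z : R[i]^o => cabs z)).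
  exact: cu.
exact: continuous_cabs.
Qed.

Lemma continuous_cabs_powR p u : 0 < p -> ccontinuous u ->
  continuous (fun t => cabs (u t) `^ p).
Proof.
by move=> p0 cu; apply: continuous_powR => //; [move=> t; exact: cabs_ge0|exact: continuous_ccabs].
Qed.

Lemma lp_norm_ge0 p u : 0 <= lp_norm p u. Proof. exact: powR_ge0. Qed.

Lemma average_cabs_ge0 p u : 0 <= average (fun t => cabs (u t) `^ p).
Proof. by apply: average_ge0 => t; exact: powR_ge0. Qed.

Lemma lp_normE p u : 0 < p -> lp_norm p u `^ p = average (fun t => cabs (u t) `^ p).
Proof.
by move=> p0; rewrite -powRrM mulVf ?gt_eqF// powRr1// average_cabs_ge0.
Qed.

Lemma parallelogram_ge2 p u v : 2 < p -> ccontinuous u -> ccontinuous v ->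
  lp_norm p (fun t => u t + v t) `^ p + lp_norm p (fun t => u t - v t) `^ p <=
  2 `^ (p - 1) * (lp_norm p u `^ p + lp_norm p v `^ p).
Proof.
move=> p2 cu cv; have p0 : 0 < p by lra.
have cu' := continuous_cabs_powR p0 cu; have cv' := continuous_cabs_powR p0 cv.
have cD := continuous_cabs_powR p0 (ccontinuousD cu cv).
have cB := continuous_cabs_powR p0 (ccontinuousB cu cv).
move: (lp_normE (fun t => u t + v t) p0) (lp_normE (fun t => u t - v t) p0).
move: (lp_normE u p0) (lp_normE v p0).
move: (lp_norm p _) (lp_norm p _) (lp_norm p _) (lp_norm p _) => na nb nc nd.
move=> -> -> -> ->.
have <- := averageD cD cB; have <- := averageD cu' cv'.
have <- := averageZ (2 `^ (p - 1)) (cts_add cu' cv').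
apply: le_average; [exact: cts_add|exact/cts_scale/cts_add|].
by move=> t; exact: clarkson_complex.
Qed.

(** With [a = u + v] and [b = u - v], [two_point_complex] bounds
    [(|a|^2 + (p-1) |b|^2)^(p/2)] pointwise by [2^(p-1) (|u|^p + |v|^p)]. The average
    of the left-hand side is handled by [reverse_minkowski], and the right-hand
    side by concavity of the power [p / 2]. *)
Lemma parallelogram_le2 p u v : 1 < p -> p <= 2 -> ccontinuous u -> ccontinuous v ->
  lp_norm p (fun t => u t + v t) ^+ 2 + (p - 1) * lp_norm p (fun t => u t - v t) ^+ 2 <=
  2 * (lp_norm p u ^+ 2 + lp_norm p v ^+ 2).
Proof.
move=> p1 p2 cu cv; have p0 : 0 < p by lra.
have e0 : 0 < p / 2 by lra. have e1 : p / 2 <= 1 by lra.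
have q0 : 0 <= p - 1 by lra.
(* The norms become variables, so that rewriting does not compare the
   integrals behind them. *)
move: (lp_norm_ge0 p (fun t => u t + v t)) (lp_normE (fun t => u t + v t) p0).
move: (lp_norm p (fun t => u t + v t)) => na na0 naE.
move: (lp_norm_ge0 p (fun t => u t - v t)) (lp_normE (fun t => u t - v t) p0).
move: (lp_norm p (fun t => u t - v t)) => nb nb0 nbE.
move: (lp_norm_ge0 p u) (lp_normE u p0); move: (lp_norm p u) => nu nu0 nuE.
move: (lp_norm_ge0 p v) (lp_normE v p0); move: (lp_norm p v) => nv nv0 nvE.
have cD := ccontinuousD cu cv. have cB := ccontinuousB cu cv.
pose f t := cabs (u t + v t) ^+ 2; pose g t := (p - 1) * cabs (u t - v t) ^+ 2.
have f0 t : 0 <= f t by exact: sqr_ge0.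
have g0 t : 0 <= g t by rewrite mulr_ge0 ?sqr_ge0.
have cf : continuous f.
  by move=> t; apply: cvgM; apply: (continuous_ccabs cD).
have cg : continuous g.
  by apply: cts_scale => t; apply: cvgM; apply: (continuous_ccabs cB).
have cuv := cts_add (continuous_cabs_powR p0 cu) (continuous_cabs_powR p0 cv).
have AE : (na ^+ 2) `^ (p / 2) = average (fun t => f t `^ (p / 2)).
  apply: (etrans (powR_sq p na0)); apply: (etrans naE).
  by apply/esym/eq_average => t; exact: (powR_sq p (cabs_ge0 (u t + v t))).
have BE : ((p - 1) * nb ^+ 2) `^ (p / 2) = average (fun t => g t `^ (p / 2)).
  apply: (etrans (powRM _ q0 (sqr_ge0 nb))).
  apply: (etrans (congr1 ( *%R _) (etrans (powR_sq p nb0) nbE))).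
  apply: (etrans (esym (averageZ _ (continuous_cabs_powR p0 cB)))).
  apply/esym/eq_average => t; apply: (etrans (powRM _ q0 (sqr_ge0 _))).
  exact: (congr1 ( *%R _) (powR_sq p (cabs_ge0 (u t - v t)))).
have B0 : 0 <= (p - 1) * nb ^+ 2 by rewrite mulr_ge0 ?sqr_ge0.
have RM := reverse_minkowski e0 e1 cf cg f0 g0 (sqr_ge0 na) B0 AE BE.
have {}RM : (na ^+ 2 + (p - 1) * nb ^+ 2) `^ (p / 2) <= 2 `^ p * ((nu `^ p + nv `^ p) / 2).
  apply: (le_trans RM).
  have -> : 2 `^ p * ((nu `^ p + nv `^ p) / 2) =
     average (fun t => 2 `^ p / 2 * (cabs (u t) `^ p + cabs (v t) `^ p)).
    rewrite averageZ// averageD; [|exact: continuous_cabs_powR..].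
    by rewrite nuE nvE; move: (average _) (average _) => X Y; field.
  apply: le_average.
  - apply: continuous_powR => //; first by move=> t; rewrite addr_ge0.
    exact: cts_add.
  - exact: cts_scale.
  move=> t; apply: (le_trans (two_point_complex _ _ p1 p2)).
  have -> : u t + v t + (u t - v t) = 2%:R * u t by ring.
  have -> : u t + v t - (u t - v t) = 2%:R * v t by ring.
  have n2 : cabs (2%:R : R[i]) = 2.
    by apply: complexI; rewrite -norm_cabs normr_nat rmorph_nat.
  rewrite !normcM n2 !(powRM p (ler0n R 2) (cabs_ge0 _)).
  by rewrite le_eqVlt; apply/orP; left; apply/eqP; field.
move: RM; clear -na0 nb0 nu0 nv0 e0 e1 q0 => RM.
have U0 := sqr_ge0 nu; have V0 := sqr_ge0 nv.
have h0 : (0 : R) <= 2^-1 by []. have h1 : (2^-1 : R) <= 1 by lra.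
have UV := powR_concave e0 e1 h0 h1 U0 V0.
rewrite !powR_sq// in UV.
have {}RM : (na ^+ 2 + (p - 1) * nb ^+ 2) `^ (p / 2) <= (2 * (nu ^+ 2 + nv ^+ 2)) `^ (p / 2).
  apply: (le_trans RM).
  have -> : 2 * (nu ^+ 2 + nv ^+ 2) = 2 ^+ 2 * (2^-1 * nu ^+ 2 + (1 - 2^-1) * nv ^+ 2) by field.
  have w0 : 0 <= 2^-1 * nu ^+ 2 + (1 - 2^-1) * nv ^+ 2 by lra.
  rewrite (powRM _ (sqr_ge0 2) w0) (powR_sq p (ler0n R 2)).
  by apply: ler_wpM2l; [exact: powR_ge0|lra].
rewrite leNgt; apply/negP => H.
have : (2 * (nu ^+ 2 + nv ^+ 2)) `^ (p / 2) < (na ^+ 2 + (p - 1) * nb ^+ 2) `^ (p / 2).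
  apply: gt0_ltr_powR => //; rewrite nnegrE.
    by rewrite mulr_ge0// addr_ge0.
  by rewrite addr_ge0 ?mulr_ge0 ?sqr_ge0.
by rewrite ltNge RM.
Qed.

(** The constant of the weak parallelogram law of exponent [pyth_r p]; see
    [pyth_KE] for its relation to [pyth_K p]. *)
Definition parallelogram_const p : R := if p <= 2 then p - 1 else 1.

Lemma parallelogram p u v : 1 < p -> ccontinuous u -> ccontinuous v ->
  lp_norm p (fun t => u t + v t) `^ pyth_r p +
    parallelogram_const p * lp_norm p (fun t => u t - v t) `^ pyth_r p <=
  2 `^ (pyth_r p - 1) * (lp_norm p u `^ pyth_r p + lp_norm p v `^ pyth_r p).
Proof.
move=> p1 cu cv; rewrite /parallelogram_const /pyth_r; case: ifPn => [p2|]; last first.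
  by rewrite -ltNge mul1r => p2; exact: parallelogram_ge2.
have := parallelogram_le2 p1 p2 cu cv.
move: (lp_norm_ge0 p (fun t => u t + v t)) (lp_norm_ge0 p (fun t => u t - v t)).
move: (lp_norm_ge0 p u) (lp_norm_ge0 p v).
move: (lp_norm p _) (lp_norm p _) (lp_norm p _) (lp_norm p _) => nu nv na nb.
move=> nu0 nv0 na0 nb0.
have -> : (2 : R) - 1 = 1 by ring.
rewrite (powRr1 (ler0n R 2)).
by rewrite (powR_mulrn 2 nu0) (powR_mulrn 2 nv0) (powR_mulrn 2 na0) (powR_mulrn 2 nb0).
Qed.

End CircleNorm.

(** * Exchanging integrals of separately continuous functions *)

Section Caratheodory.
Context {R : realType}.
Implicit Types (x y t : R) (G : R -> R -> R).
Notation mu := (@lebesgue_measure R).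

Definition floor_grid (n : nat) x : R := (Num.floor (x * n.+1%:R))%:~R / n.+1%:R.

Lemma cvg_floor_grid x : floor_grid ^~ x @ \oo --> x.
Proof.
apply/cvgrPdist_le => e e0; near=> n.
have n0 : (0 : R) < n.+1%:R by [].
rewrite /floor_grid ger0_norm; last first.
  by rewrite subr_ge0 ler_pdivrMr// ge_floor.
rewrite lerBlDr -lerBlDl ler_pdivlMr// mulrBl.
have := floorD1_gt (x * n.+1%:R); rewrite intrD => H.
have : 1 <= e * n.+1%:R.
  rewrite -ler_pdivrMl// mulr1 (le_trans (ltW (archi_boundP _)))//.
    by rewrite invr_ge0 ltW.
  by rewrite ler_nat; near: n; exists (Num.bound e^-1) => // m /= /leqW.
have {}H : x * n.+1%:R < (Num.floor (x * n.+1%:R))%:~R + 1 by [].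
lra.
Unshelve. all: by end_near.
Qed.

Lemma measurable_floor_fiber (n : nat) (k : int) :
  measurable [set x : R | Num.floor (x * n.+1%:R) = k].
Proof.
have -> : [set x : R | Num.floor (x * n.+1%:R) = k] =
  [set` `[(k%:~R / n.+1%:R), ((k + 1)%:~R / n.+1%:R)[].
  apply/seteqP; split => x /=; rewrite in_itv/= ler_pdivrMr// ltr_pdivlMr//.
    by move=> <-; rewrite ge_floor floorD1_gt.
  by move=> H; apply/eqP; rewrite floor_eq.
exact: measurable_itv.
Qed.

(** Freezing the first variable on [floor_grid n] gives functions that are
    measurable, since they are given by countably many continuous functions on
    vertical strips, and they converge pointwise by continuity in the first
    variable. *)
Lemma caratheodory_measurable G : (forall y, continuous (G ^~ y)) ->
  (forall x, continuous (G x)) ->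
  measurable_fun setT (fun xy : R * R => G xy.1 xy.2).
Proof.
move=> cG1 cG2.
apply: (@measurable_fun_cvg _ _ _ _ (fun n xy => G (floor_grid n xy.1) xy.2)).
- move=> n _ Y mY; rewrite setTI.
  have -> : (fun xy : R * R => G (floor_grid n xy.1) xy.2) @^-1` Y =
    \bigcup_(k : int) ([set x : R | Num.floor (x * n.+1%:R) = k] `*`
       [set y | Y (G (k%:~R / n.+1%:R) y)]).
    apply/seteqP; split => [[x y] /= Yxy|[x y] [k _ [/= <-]]] //.
    by exists (Num.floor (x * n.+1%:R)).
  apply: countable_bigcupT_measurable; first exact: countableP.
  move=> k; apply: measurableX; first exact: measurable_floor_fiber.
  rewrite -[X in measurable X]setTI.
  by apply: (continuous_measurable_fun (cG2 _)).
- move=> [x y] _ /=.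
  exact: (cvg_comp _ _ (@cvg_floor_grid x) (cG1 y x)).
Qed.

(** Tonelli's theorem on the rectangle, thanks to [caratheodory_measurable]. *)
Lemma swap_segint G a b c d : (forall x y, 0 <= G x y) ->
  (forall y, continuous (G ^~ y)) -> (forall x, continuous (G x)) ->
  (\int[mu]_(x in `[a, b]) \int[mu]_(y in `[c, d]) (G x y)%:E =
   \int[mu]_(y in `[c, d]) \int[mu]_(x in `[a, b]) (G x y)%:E)%E.
Proof.
move=> G0 cG1 cG2.
pose F := (fun xy : R * R => (G xy.1 xy.2)%:E) \_ (`[a, b] `*` `[c, d]).
have mF : measurable_fun setT F.
  apply/(measurable_restrictT _ _).1; first by apply: measurableX.
  apply: measurable_funTS; apply/measurable_EFinP.
  exact: caratheodory_measurable.
have F0 xy : (0 <= F xy)%E.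
  by rewrite /F patchE; case: ifPn => // _; rewrite lee_fin.
have FE x y : F (x, y) = if (x \in `[a, b]) && (y \in `[c, d]) then (G x y)%:E else 0%E.
  by rewrite /F patchE in_setX/= !mem_setE.
have := @fubini_tonelli _ _ _ _ R mu mu F mF F0.
have -> : (\int[mu]_x \int[mu]_y F (x, y) =
    \int[mu]_(x in `[a, b]) \int[mu]_(y in `[c, d]) (G x y)%:E)%E.
  rewrite [RHS]integral_mkcond; apply: eq_integral => x _.
  rewrite patchE mem_setE; case: ifPn => xab; last first.
    by apply: integral0_eq => y _; rewrite FE (negbTE xab).
  rewrite [RHS]integral_mkcond; apply: eq_integral => y _.
  by rewrite FE xab /= patchE mem_setE.
move=> ->.
rewrite [RHS]integral_mkcond; apply: eq_integral => y _.
rewrite patchE mem_setE; case: ifPn => ycd; last first.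
  by apply: integral0_eq => x _; rewrite FE (negbTE ycd) andbF.
rewrite [RHS]integral_mkcond; apply: eq_integral => x _.
by rewrite FE ycd andbT patchE mem_setE.
Qed.

Lemma measurable_partial_integral G c d : (forall x y, 0 <= G x y) ->
  (forall y, continuous (G ^~ y)) -> (forall x, continuous (G x)) ->
  measurable_fun setT (fun x => (\int[mu]_(y in `[c, d]) (G x y)%:E)%E).
Proof.
move=> G0 cG1 cG2.
pose F := (fun xy : R * R => (G xy.1 xy.2)%:E) \_ (setT `*` `[c, d]).
have mF : measurable_fun setT F.
  apply/(measurable_restrictT _ _).1; first by apply: measurableX.
  apply: measurable_funTS; apply/measurable_EFinP.
  exact: caratheodory_measurable.
have F0 xy : (0 <= F xy)%E.
  by rewrite /F patchE; case: ifPn => // _; rewrite lee_fin.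
have := @measurable_fun_fubini_tonelli_F _ _ _ _ R mu F mF F0.
congr (measurable_fun _ _); apply/funext => x; rewrite /fubini_F.
rewrite [RHS]integral_mkcond; apply: eq_integral => y _.
by rewrite /F !patchE in_setX/= in_setT.
Qed.

End Caratheodory.

(** * Rotation of circle averages *)

Section Shift.
Context {R : realType}.
Implicit Types (a b t x al : R) (f : R -> R).

Lemma segint_shift a b al f : a <= b -> continuous f ->
  segint (a + al) (b + al) f = segint a b (fun x => f (x + al)).
Proof.
move=> ab cf.
have dF (x : R) : is_derive x (1 : R) (fun x => x + al) 1.
  by apply: is_derive_eq; ring.
have FE : derive1 (fun x : R => x + al) = cst 1.
  by apply/funext => x; rewrite derive1E derive_val.
have cF : continuous (fun x : R => x + al).
  by move=> x; apply: cvgD; [exact: cvg_id|exact: cvg_cst].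
have := @integration_by_substitution_increasing R (fun x => x + al) f a b ab.
rewrite FE => H; rewrite /segint /Rintegral H.
- by congr fine; apply: eq_integral => x _ /=; rewrite fctE /= mulr1.
- by move=> x y _ _ xy; rewrite ltrD2r.
- by move=> x _; exact: cvg_cst.
- exact: is_cvg_cst.
- exact: is_cvg_cst.
- split; [by move=> x _|exact/cvg_at_right_filter/cF|exact/cvg_at_left_filter/cF].
- exact/cts_on_within/cts_onW.
Qed.

(** The part of the period pushed beyond [2 * pi] comes back at 0. *)
Lemma average_shift f t : 0 <= t <= 2 * pi -> continuous f ->
  (forall x, f (x + 2 * pi) = f x) -> average (fun x => f (x + t)) = average f.
Proof.
move=> /andP[t0 t2] cf per; rewrite /average; congr (_ * _).
have p2 := ltW (@pi2_gt0 R).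
rewrite -(segint_shift t p2 cf) add0r.
rewrite (@segint_split _ t (2 * pi))//; [|by rewrite lerDl|exact: cts_onW].
rewrite [RHS](@segint_split _ 0 t)//; last exact: cts_onW.
rewrite addrC; congr (_ + _).
rewrite -[X in segint X]add0r (addrC (2 * pi) t) segint_shift//.
by apply: eq_segint => x _; exact: per.
Qed.

(** The angle is taken in [[0, 2 * pi]], the range of rotations covered by
    [average_shift]. *)
Lemma polar (z : R[i]) : exists2 t, 0 <= t <= 2 * pi & z = circle_pt (cabs z) t.
Proof.
have p0 := @pi_gt0 R.
have [->|z0] := eqVneq z 0.
  by exists 0; [rewrite lexx mulr_ge0 ?pi_ge0|rewrite normc0 /circle_pt !mul0r].
set r := cabs z.
have r0 : 0 < r.
  rewrite lt_neqAle cabs_ge0 andbT eq_sym; apply: contra_neq z0.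
  exact: eq0_normc.
set x := complex.Re z; set y := complex.Im z.
have xy : x ^+ 2 + y ^+ 2 = r ^+ 2 by rewrite /r cabs_sq.
have xr : -1 <= x / r <= 1.
  by rewrite ler_pdivrMr// ler_pdivlMr// mulN1r mul1r -ler_norml Re_le_cabs.
set s := acos (x / r).
have cs : r * cos s = x by rewrite /s acosK// mulrC divfK// gt_eqF.
have ss : r * sin s = `|y|.
  rewrite /s sin_acos// -{1}(gtr0_norm r0) -sqrtr_sqr -sqrtrM ?sqr_ge0//.
  rewrite mulrBr mulr1 expr_div_n mulrC divfK ?expf_neq0 ?gt_eqF//.
  by rewrite -xy addrC addKr sqrtr_sqr.
have s0 : 0 <= s by exact: acos_ge0.
have spi : s <= pi by exact: acos_lepi.
have zE : z = (x +i* y)%C by rewrite /x /y; case: (z).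
have [y0|y0] := leP 0 y.
  exists s; first by rewrite s0/=; lra.
  by rewrite /circle_pt cs ss ger0_norm.
exists (2 * pi - s); first by lra.
have c2 : cos (2 * pi - s) = cos s.
  by rewrite addrC mulr_natl cosD2pi cosN.
have s2 : sin (2 * pi - s) = - sin s.
  by rewrite addrC mulr_natl sinD2pi sinN.
by rewrite /circle_pt c2 s2 cs mulrN ss ltr0_norm// opprK.
Qed.
End Shift.

(** * The submean inequality *)

Section Submean.
Context {R : realType}.
Implicit Types (a b t x r p e : R) (h : R[i] -> R[i]) (z w c : R[i]).
Notation P := circle_pt.

Lemma derivable_affine h z0 c z : derivable (h : R[i]^o -> R[i]^o) (z0 + c * z) 1 ->
  derivable ((fun z => h (z0 + c * z)) : R[i]^o -> R[i]^o) z 1.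
Proof.
move=> /derivable1_diffP dh; apply/derivable1_diffP.
have dl : derivable (fun z : R[i]^o => c * z : R[i]^o) z 1.
  have := @derivableZ _ R[i]^o R[i]^o (fun z => z) c z 1 (@derivable_id _ R[i]^o z 1).
  by apply.
have da : derivable (fun z : R[i]^o => z0 + c * z : R[i]^o) z 1.
  have := @derivableD _ R[i]^o R[i]^o (fun=> z0) _ z 1 (@derivable_cst _ R[i]^o R[i]^o z0 z 1) dl.
  by apply.
move/derivable1_diffP : da => da.
have := @differentiable_comp _ R[i]^o R[i]^o R[i]^o _ (h : R[i]^o -> R[i]^o) z da dh.
by apply.
Qed.

(** Multiply [h] by a unimodular constant that makes [h 0] equal to its modulus
    [m], and integrate the tangent line of the p-th power at [m]: its linear part
    has average 0 by the mean value property. *)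
Lemma circle_submean p h D r : 1 < p ->
  (forall z, cabs z < D -> derivable (h : R[i]^o -> R[i]^o) z 1) -> 0 <= r < D ->
  cabs (h 0) `^ p <= average (fun t => cabs (h (P r t)) `^ p).
Proof.
move=> p1 hh rD; have p0 : 0 < p by lra.
have rD' : `|r| < D by rewrite ger0_norm; lra.
set m := cabs (h 0).
have [m_0|mN0] := eqVneq m 0.
  rewrite m_0 powR0 ?gt_eqF//; apply: average_ge0 => t; exact: powR_ge0.
have m0 : 0 < m by rewrite lt_neqAle eq_sym mN0 cabs_ge0.
have h0 : h 0 != 0 by apply: contra_neq mN0; rewrite /m => ->; exact: normc0.
pose c : R[i] := m%:C%C / h 0.
have c1 : cabs c = 1.
  rewrite /c normcM normcV -/m /= expr0n addr0 sqrtr_sqr gtr0_norm//.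
  by rewrite divff.
pose g z := c * h z.
have hg z : cabs z < D -> derivable (g : R[i]^o -> R[i]^o) z 1.
  by move=> zD; have := @derivableZ _ R[i]^o R[i]^o h c z 1 (hh z zD); apply.
have mg : average (fun t => complex.Re (g (P r t))) = m.
  rewrite /average (mean_value hg rD) mulrA mulVf ?gt_eqF ?pi2_gt0// mul1r.
  by rewrite /g /c divfK.
have cg : continuous (fun t => complex.Re (g (P r t))).
  exact: (continuous_angle hg (@continuous_Re R) rD').
have ch : continuous (fun t => cabs (h (P r t)) `^ p).
  apply: continuous_powR => //; first by move=> t; exact: cabs_ge0.
  exact: (continuous_angle hh (@continuous_cabs R) rD').
pose k := p * m `^ (p - 1).
have cc (y : R) : continuous (fun _ : R => y) by move=> ?; exact: cvg_cst.
have k0 : 0 <= k by rewrite mulr_ge0 ?powR_ge0// ltW.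
have -> : m `^ p = average (fun t => (m `^ p - k * m) + k * complex.Re (g (P r t))).
  rewrite (averageD (cc _) (@cts_scale _ k _ cg)) average_cst (averageZ k cg) mg.
  by rewrite subrK.
apply: le_average => //; first exact: (cts_add (cc _) (@cts_scale _ k _ cg)).
move=> t; apply: le_trans (powR_ge_tangent p1 m0 (cabs_ge0 (h (P r t)))).
rewrite -addrA lerD2l -/k mulrBr addrC lerD2r ler_wpM2l//.
apply: le_trans (ler_norm _) _; apply: le_trans (Re_le_cabs _) _.
by rewrite /g normcM c1 mul1r.
Qed.

Lemma circle_ptM r s t : P r s * P 1 t = P r (s + t) :> R[i].
Proof.
rewrite /P !mul1r; apply/eqP; rewrite eq_complex /= cosD sinD.
by apply/andP; split; apply/eqP; ring.
Qed.

Lemma continuous_circle_pt : continuous (fun xt : R * R => P xt.1 xt.2 : R[i]^o).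
Proof.
move=> [x t].
have -> : (fun xt : R * R => P xt.1 xt.2 : R[i]^o) =
  (fun xt : R * R => P xt.1 0 * P 1 xt.2 : R[i]^o).
  by apply/funext => -[y s] /=; rewrite circle_ptM add0r.
apply: cvgM.
  apply: (@continuous_comp _ _ _ fst (fun x => P x 0 : R[i]^o)); first exact: cvg_fst.
  exact: continuous_circle_pt_radius.
apply: (@continuous_comp _ _ _ snd (fun t => P 1 t : R[i]^o)); first exact: cvg_snd.
exact: continuous_circle_pt_angle.
Qed.
End Submean.

(** * Monotonicity of the p-means of a holomorphic function *)

Section RadialMaximum.
Context {R : realType} (U : R -> R).
Implicit Types (a b r s e d : R).
Notation P := circle_pt.
Hypothesis cU : forall r, `|r| < 1 -> {for r, continuous U}.
Hypothesis subU : forall r e, 0 <= r -> 0 <= e -> r + e < 1 ->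
  U r <= average (fun s => U (cabs (r%:C%C + P e s))).

Lemma cabs_real r : 0 <= r -> cabs r%:C%C = r.
Proof. by move=> r0; rewrite /= expr0n addr0 sqrtr_sqr ger0_norm. Qed.

Lemma average_cos : average (@cos R) = 0.
Proof.
have ds (x : R) : is_derive x (1 : R) sin (cos x) by exact: is_derive_sin.
rewrite /average (segint_FTC (ltW (@pi2_gt0 R)) (@continuous_cos R) ds).
by rewrite -[X in sin X - _]add0r mulr_natl sinD2pi subrr mulr0.
Qed.

(** If [U a > U b], add a small multiple of the strictly subharmonic function
    [r^2] to [U] and take a maximum point [r] of the sum on [[0, b]]; it is not [b].
    The submean inequality on the circle of center [r] and radius [b - r], which
    stays in the disk of radius [b], contradicts maximality. *)
Lemma radial_maximum a b : 0 <= a -> a <= b -> b < 1 -> U a <= U b.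
Proof.
move=> a0 ab b1; rewrite leNgt; apply/negP => Uab.
pose d := (U a - U b) / 2.
have d0 : 0 < d by rewrite /d; lra.
pose W r := U r + d * r ^+ 2.
have b0 : 0 <= b by lra.
have cW : {within `[0, b], continuous W}.
  apply: cts_on_within; apply: cts_onD.
    by move=> r r0b; apply: cU; rewrite ger0_norm; lra.
  apply: cts_onW; apply: cts_scale => r; apply: cvgM; exact: cvg_id.
have [r /[!in_itv]/= /andP[r0 rb] rmax] := EVT_max b0 cW.
have rltb : r < b.
  rewrite lt_neqAle rb andbT; apply/eqP => rE.
  have := rmax a; rewrite in_itv/= a0 ab rE => /(_ isT).
  have b21 : b ^+ 2 <= 1 by rewrite expr_le1// ltW.
  have := ler_wpM2l (ltW d0) b21.
  have : 0 <= d * a ^+ 2 by rewrite mulr_ge0 ?sqr_ge0// ltW.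
  by rewrite /W /d; lra.
pose e := b - r.
have e0 : 0 < e by rewrite /e; lra.
have reb : r + e = b by rewrite /e; ring.
have re1 : r + e < 1 by rewrite reb.
have := subU r0 (ltW e0) re1; rewrite leNgt; move/negP; apply.
have in_b s : cabs (r%:C%C + P e s) <= b.
  rewrite -reb; apply: le_trans (cabsD _ _) _.
  by rewrite cabs_circle_pt (gtr0_norm e0) cabs_real.
have sqE s : cabs (r%:C%C + P e s) ^+ 2 = (r ^+ 2 + e ^+ 2) + (2 * r * e) * cos s.
  rewrite cabs_sqD cabs_circle_pt cabs_real// real_normK ?num_real// /re_dot /=.
  by ring.
have cV : continuous (fun s => U (cabs (r%:C%C + P e s))).
  move=> s.
  have cz : {for s, continuous (fun s => r%:C%C + P e s : R[i]^o)}.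
    by apply: cvgD; [exact: cvg_cst|exact: continuous_circle_pt_angle].
  have c2 := @continuous_comp _ _ _ _ (fun z : R[i]^o => cabs z) s cz (@continuous_cabs R _).
  apply: (@continuous_comp _ _ _ _ U s c2); apply: cU.
  by rewrite ger0_norm ?cabs_ge0//; exact: le_lt_trans (in_b s) b1.
have cc (y : R) : continuous (fun _ : R => y) by move=> ?; exact: cvg_cst.
pose k1 := W r - d * (r ^+ 2 + e ^+ 2); pose k2 := - (d * (2 * r * e)).
have cR : continuous (fun s => k1 + k2 * cos s).
  by apply: cts_add => //; apply: cts_scale; exact: continuous_cos.
apply: (@le_lt_trans _ _ (average (fun s => k1 + k2 * cos s))).
  apply: le_average => // s.
  have := in_b s; have := sqE s.
  move: (r%:C%C + P e s) => z zE zb.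
  have zI : cabs z \in `[0, b] by rewrite in_itv/= cabs_ge0.
  have := rmax _ zI; rewrite /W zE /k1 /k2 /W; lra.
rewrite (averageD (cc k1) (@cts_scale _ k2 _ (@continuous_cos R))).
rewrite average_cst (averageZ k2 (@continuous_cos R)) average_cos mulr0 addr0.
have : 0 < d * e ^+ 2 by rewrite mulr_gt0// exprn_gt0.
by rewrite /k1 /W; lra.
Qed.
End RadialMaximum.

Section Monotone.
Context {R : realType} (p : R) (h : R[i] -> R[i]).
Hypothesis p1 : 1 < p.
Hypothesis hh : holomorphic_disk h.
Implicit Types (a b t x r s e d : R) (z w c : R[i]).
Notation P := circle_pt.
Notation mu := (@lebesgue_measure R).

Definition pmean r := average (fun t => cabs (h (P r t)) `^ p).

Let p0 : 0 < p. Proof. exact: lt_trans ltr01 p1. Qed.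

Let cph z : cabs z < 1 -> {for z, continuous (fun z : R[i]^o => cabs (h z) `^ p)}.
Proof.
move=> z1; have ch := holomorphic_continuous (hh z1).
have -> : (fun z : R[i]^o => cabs (h z) `^ p) = (fun z : R[i]^o => `|cabs (h z)| `^ p).
  by apply/funext => w; rewrite (ger0_norm (cabs_ge0 _)).
have c2 := @continuous_comp _ _ _ (h : R[i]^o -> R[i]^o) (fun z : R[i]^o => cabs z) z ch (@continuous_cabs R _).
have c3 : {for cabs (h z), continuous (fun y : R => `|y| `^ p)}.
  exact: continuous_abs_powR.
have := @continuous_comp R[i]^o R R (fun z : R[i]^o => cabs (h z)) (fun y => `|y| `^ p) z c2 c3.
by apply.
Qed.

Let cph_r t r : `|r| < 1 -> {for r, continuous (fun r => cabs (h (P r t)) `^ p)}.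
Proof.
move=> r1; have c1 : {for P r t, continuous (fun z : R[i]^o => cabs (h z) `^ p)}.
  by apply: cph; rewrite cabs_circle_pt.
exact: (@continuous_comp _ _ _ (fun r => P r t : R[i]^o) _ r (@continuous_circle_pt_radius R t r) c1).
Qed.

Let cph_t r : `|r| < 1 -> continuous (fun t => cabs (h (P r t)) `^ p).
Proof.
move=> r1 t; have c1 : {for P r t, continuous (fun z : R[i]^o => cabs (h z) `^ p)}.
  by apply: cph; rewrite cabs_circle_pt.
exact: (@continuous_comp _ _ _ (fun t => P r t : R[i]^o) _ t (@continuous_circle_pt_angle R r t) c1).
Qed.

Lemma pmean_rotate z : cabs z < 1 ->
  average (fun t => cabs (h (z * P 1 t)) `^ p) = pmean (cabs z).
Proof.
move=> z1; have [s s02 zE] := polar z.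
have r1 : `|cabs z| < 1 by rewrite ger0_norm ?cabs_ge0.
rewrite /pmean -(average_shift s02 (cph_t r1)); last by move=> x; rewrite circle_ptD2pi.
apply: eq_average => t; rewrite {1}zE circle_ptM; congr (cabs (h (P _ _)) `^ _).
exact: addrC.
Qed.

(** Compactness of the polar rectangle; the bound serves as a dominating
    function for the continuity of [pmean]. *)
Lemma pmean_bounded r : 0 <= r < 1 -> exists M, forall x t, `|x| <= r ->
  0 <= t <= 2 * pi -> cabs (h (P x t)) `^ p <= M.
Proof.
move=> r01.
pose f := (fun xt : R * R => cabs (h (P xt.1 xt.2)) `^ p).
pose A := (`[- r, r] `*` `[0, 2 * pi])%classic : set (R * R).
have cA : compact A by apply: compact_setX; exact: segment_compact.
have cf : {within A, continuous f}.
  apply: continuous_in_subspaceT => -[x t]; rewrite inE => -[/=].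
  rewrite in_itv/= => xr _.
  have c1 : {for P x t, continuous (fun z : R[i]^o => cabs (h z) `^ p)}.
    by apply: cph; rewrite cabs_circle_pt ltr_norml; lra.
  exact: (@continuous_comp _ _ _ (fun xt : R * R => P xt.1 xt.2 : R[i]^o) _ (x, t) (@continuous_circle_pt R (x, t)) c1).
have [M [_ HM]] := compact_bounded (continuous_compact cf cA).
exists (M + 1) => x t xr t2.
apply: le_trans (ler_norm _) _.
apply: (HM (M + 1)); first by rewrite ltrDl.
exists (x, t) => //; split => /=; rewrite in_itv/=; last by [].
by rewrite -ler_norml.
Qed.

Lemma pmean_continuous r : `|r| < 1 -> {for r, continuous pmean}.
Proof.
move=> r1; pose b := (1 + `|r|) / 2.
have r0 := normr_ge0 r.
have b01 : 0 <= b < 1 by rewrite /b; lra.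
have [M HM] := pmean_bounded b01.
apply: cvgM; first exact: cvg_cst.
have mI : measurable (`[0, 2 * pi]%classic : set R) by exact: measurable_itv.
have xb x : x \in `]- b, b[%classic -> `|x| < b.
  by rewrite inE/= in_itv/= ltr_norml.
have b1 x : `|x| < b -> `|x| < 1 by move=> ?; lra.
apply: (@continuity_under_integral _ _ _ mu
  (fun x t => cabs (h (P x t)) `^ p) _ mI (- b) b _ _ (fun=> M)).
- by move=> x xI; apply/cts_on_integrable/cts_onW/cph_t/b1/xb; rewrite inE.
- by apply: aeW => t _ x xI; apply/cph_r/b1/xb.
- exact/cts_on_integrable/cts_on_cst.
- move=> x xI; apply: aeW => t; rewrite /= in_itv/= => tI.
  by rewrite ger0_norm ?powR_ge0// HM// ltW// xb// inE.
- by rewrite inE/= in_itv/= -ltr_norml /b; lra.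
Qed.

(** The submean inequality for the function [h] rotated by [t], averaged over [t].
    After Tonelli's theorem, the inner average is taken over a full circle around
    the origin, hence depends on the modulus only. *)
Lemma pmean_submean r e : 0 <= r -> 0 <= e -> r + e < 1 ->
  pmean r <= average (fun s => pmean (cabs (r%:C%C + P e s))).
Proof.
move=> r0 e0 re1.
(* [G t s] is the p-th power of the modulus of [h], rotated by [t], at the
   point of angle [s] of the circle of center [r] and radius [e]. *)
pose G t s := cabs (h ((r%:C%C + P e s) * P 1 t)) `^ p.
have inside s : cabs (r%:C%C + P e s) < 1.
  apply: le_lt_trans (cabsD _ _) _; rewrite cabs_circle_pt (ger0_norm e0).
  by rewrite /= expr0n addr0 sqrtr_sqr ger0_norm.
have inside2 s t : cabs ((r%:C%C + P e s) * P 1 t) < 1.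
  by rewrite normcM cabs_circle_pt normr1 mulr1.
have G0 t s : 0 <= G t s by exact: powR_ge0.
have cG1 s : continuous (G ^~ s).
  move=> t.
  have cz : {for t, continuous (fun t => (r%:C%C + P e s) * P 1 t : R[i]^o)}.
    by apply: cvgM; [exact: cvg_cst|exact: continuous_circle_pt_angle].
  exact: (@continuous_comp _ _ _ _ _ t cz (cph (inside2 s t))).
have cG2 t : continuous (G t).
  move=> s.
  have cz : {for s, continuous (fun s => (r%:C%C + P e s) * P 1 t : R[i]^o)}.
    apply: cvgM; last exact: cvg_cst.
    by apply: cvgD; [exact: cvg_cst|exact: continuous_circle_pt_angle].
  exact: (@continuous_comp _ _ _ _ _ s cz (cph (inside2 s t))).
have local_sub t : cabs (h (P r t)) `^ p <= average (G t).
  have := @circle_submean R p (fun z => h (P r t + P 1 t * z)) (1 - r) e p1.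
  rewrite mulr0 addr0 => H; apply: le_trans (H _ _) _.
  - move=> z zr; apply: derivable_affine; apply: hh.
    apply: le_lt_trans (cabsD _ _) _; rewrite normcM !cabs_circle_pt normr1 mul1r ger0_norm//.
    by lra.
  - by lra.
  rewrite le_eqVlt; apply/orP; left; apply/eqP; apply: eq_average => s.
  rewrite /G; congr (cabs (h _) `^ _).
  rewrite [RHS]mulrDl; congr (_ + _); last exact: mulrC.
  by rewrite /P; simpc.
have r1 : `|r| < 1 by rewrite ger0_norm//; lra.
have K0 := @pi2_gt0 R.
pose V s := pmean (cabs (r%:C%C + P e s)).
have cV : continuous V.
  move=> s.
  have cz : {for s, continuous (fun s => r%:C%C + P e s : R[i]^o)}.
    by apply: cvgD; [exact: cvg_cst|exact: continuous_circle_pt_angle].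
  have c2 := @continuous_comp _ _ _ _ (fun z : R[i]^o => cabs z) s cz (@continuous_cabs R _).
  apply: (@continuous_comp _ _ _ _ pmean s c2); apply: pmean_continuous.
  by rewrite ger0_norm ?cabs_ge0 ?inside.
have segintE f a b : continuous f -> ((segint a b f)%:E = \int[mu]_(x in `[a, b]) (f x)%:E)%E.
  move=> cf; rewrite /segint /Rintegral fineK//.
  by apply: integrable_fin_num => //; exact/cts_on_integrable/cts_onW.
have E1 : (\int[mu]_(t in `[0%R, (2 * pi)%R]) (2 * pi * cabs (h (P r t)) `^ p)%R%:E <=
   \int[mu]_(t in `[0%R, (2 * pi)%R]) \int[mu]_(s in `[0%R, (2 * pi)%R]) (G t s)%:E)%E.
  apply: ge0_le_integral => //.
  - by move=> t _; rewrite lee_fin mulr_ge0 ?powR_ge0// ltW.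
  - apply: measurable_funTS; apply/measurable_EFinP.
    by apply: continuous_measurable_fun; apply: cts_scale; exact: cph_t.
  - apply: measurable_funTS; exact: (measurable_partial_integral _ _ G0 cG1 cG2).
  - move=> t _; rewrite -segintE// lee_fin mulrC -ler_pdivlMr// mulrC.
    exact: local_sub.
have E2 : ((2 * pi) * segint 0 (2 * pi) (fun t => cabs (h (P r t)) `^ p) <=
   2 * pi * segint 0 (2 * pi) V).
  rewrite -!segintZ; [|exact: cts_onW|apply: cts_onW; exact: cph_t].
  rewrite -lee_fin !segintE; [|exact: cts_scale|apply: cts_scale; exact: cph_t].
  apply: (le_trans E1); rewrite swap_segint//.
  rewrite le_eqVlt; apply/orP; left; apply/eqP; apply: eq_integral => s _.
  rewrite -segintE//; congr (_%:E); rewrite /V -(pmean_rotate (inside s)) /average.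
  by rewrite mulrA mulfV ?mul1r// gt_eqF.
by rewrite /pmean /average ler_wpM2l ?pi2V_ge0//; move: E2; rewrite ler_pM2l.
Qed.

(** Due to Hardy; here it is [radial_maximum] for the function [pmean]. *)
Lemma pmean_nondecreasing a b : 0 <= a -> a <= b -> b < 1 -> pmean a <= pmean b.
Proof. exact: (radial_maximum pmean_continuous pmean_submean). Qed.

End Monotone.

(** * The norm of the Hardy space *)

Section Hardy.
Context {R : realType} (p : R).
Hypothesis p1 : 1 < p.
Implicit Types (a b t x r s e d B : R) (f g : R[i] -> R[i]) (z w c : R[i]).
Notation P := circle_pt.

Let p0 : 0 < p. Proof. exact: lt_trans ltr01 p1. Qed.

Definition circle_norm f r := lp_norm p (fun t => f (P r t)).

Definition hnorm f := fine (hardy_norm p f).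

Lemma ccontinuous_circle f r : holomorphic_disk f -> `|r| < 1 ->
  ccontinuous (fun t => f (P r t)).
Proof.
move=> hf r1 t.
have ch : {for P r t, continuous (f : R[i]^o -> R[i]^o)}.
  by apply/holomorphic_continuous/hf; rewrite cabs_circle_pt.
exact: (@continuous_comp _ _ _ (fun t => P r t : R[i]^o) (f : R[i]^o -> R[i]^o) t (@continuous_circle_pt_angle R r t) ch).
Qed.

Lemma circle_meanE f r : holomorphic_disk f -> 0 <= r < 1 ->
  circle_mean p f r = (circle_norm f r `^ p)%:E.
Proof.
move=> hf r01; have r1 : `|r| < 1 by rewrite ger0_norm; lra.
have cf := continuous_cabs_powR p0 (ccontinuous_circle hf r1).
rewrite /circle_mean (lp_normE _ p0) /average /segint /Rintegral EFinM fineK//.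
by apply: integrable_fin_num => //; exact/cts_on_integrable/cts_onW.
Qed.

Lemma circle_norm_ge0 f r : 0 <= circle_norm f r.
Proof. exact: lp_norm_ge0. Qed.

Lemma circle_norm_mono f a b : holomorphic_disk f -> 0 <= a -> a <= b -> b < 1 ->
  circle_norm f a <= circle_norm f b.
Proof.
move=> hf a0 ab b1; apply: ge0_ler_powR.
- by rewrite invr_ge0 ltW.
- by rewrite nnegrE average_cabs_ge0.
- by rewrite nnegrE average_cabs_ge0.
exact: (pmean_nondecreasing p1 hf a0 ab b1).
Qed.

Lemma le_circle_norm f g a : holomorphic_disk f -> holomorphic_disk g ->
  0 <= a < 1 -> (forall t, cabs (f (P a t)) <= cabs (g (P a t))) ->
  circle_norm f a <= circle_norm g a.
Proof.
move=> hf hg a01 fg; have a1 : `|a| < 1 by rewrite ger0_norm; lra.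
apply: ge0_ler_powR.
- by rewrite invr_ge0 ltW.
- by rewrite nnegrE average_cabs_ge0.
- by rewrite nnegrE average_cabs_ge0.
apply: le_average.
- exact: (continuous_cabs_powR p0 (ccontinuous_circle hf a1)).
- exact: (continuous_cabs_powR p0 (ccontinuous_circle hg a1)).
by move=> t; apply: ge0_ler_powR; rewrite ?nnegrE ?cabs_ge0 ?(ltW p0).
Qed.

Lemma circle_norm0 f : circle_norm f 0 = cabs (f 0).
Proof.
rewrite /circle_norm /lp_norm (@eq_average _ _ (fun=> cabs (f 0) `^ p)).
  by rewrite average_cst -powRrM mulfV ?gt_eqF// powRr1// cabs_ge0.
by move=> t; rewrite /P !mul0r.
Qed.

Lemma circle_normZ c f r : holomorphic_disk f -> 0 <= r < 1 ->
  circle_norm (fun z => c * f z) r = cabs c * circle_norm f r.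
Proof.
move=> hf r01; have r1 : `|r| < 1 by rewrite ger0_norm; lra.
have cf := continuous_cabs_powR p0 (ccontinuous_circle hf r1).
rewrite /circle_norm /lp_norm.
rewrite (@eq_average _ _ (fun t => cabs c `^ p * cabs (f (P r t)) `^ p)); last first.
  by move=> t; rewrite normcM powRM ?cabs_ge0.
rewrite (averageZ _ cf) powRM ?powR_ge0 ?average_cabs_ge0//.
by rewrite -powRrM mulfV ?gt_eqF// powRr1// cabs_ge0.
Qed.

Lemma hnorm_ge0 f : 0 <= hnorm f.
Proof. by rewrite /hnorm fine_ge0// poweR_ge0. Qed.

Lemma circle_norm_le_hnorm f r : hardy p f -> 0 <= r < 1 ->
  circle_norm f r <= hnorm f.
Proof.
case=> hf hfin r01; rewrite /hnorm /hardy_norm fine_poweR.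
have pV0 : 0 < p^-1 by rewrite invr_gt0.
have mr : (circle_mean p f r <= ereal_sup [set circle_mean p f rho | rho in [set` `[0%R, 1%R[ ]])%E.
  by apply: ereal_sup_ubound; exists r => //=; rewrite in_itv.
have sfin : (ereal_sup [set circle_mean p f rho | rho in [set` `[0%R, 1%R[ ]] < +oo)%E.
  exact: (lty_poweRy (lt0r_neq0 pV0) hfin).
move: mr sfin; rewrite (circle_meanE hf r01).
have cr0 := circle_norm_ge0 f r.
case: (ereal_sup _) => [S| |] //=; rewrite lee_fin => rS _.
have -> : circle_norm f r = (circle_norm f r `^ p) `^ p^-1.
  by rewrite -powRrM mulfV ?gt_eqF// powRr1.
have S0 : 0 <= S := le_trans (powR_ge0 _ _) rS.
by apply: ge0_ler_powR; rewrite ?nnegrE ?powR_ge0 ?(ltW pV0).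
Qed.

Lemma hnorm_le f B : holomorphic_disk f -> 0 <= B ->
  (forall r, 0 <= r < 1 -> circle_norm f r <= B) -> hardy p f /\ hnorm f <= B.
Proof.
move=> hf B0 HB.
have pV0 : 0 < p^-1 by rewrite invr_gt0.
have le : (hardy_norm p f <= B%:E)%E.
  have -> : B%:E = ((B `^ p)%:E `^ p^-1)%E.
    by rewrite poweR_EFin -powRrM mulfV ?gt_eqF// powRr1.
  apply: gt0_ler_poweR; first exact: ltW.
  - rewrite in_itv/= leey andbT.
    apply: (@le_trans _ _ (circle_mean p f 0)).
      by rewrite circle_meanE ?lexx ?ltr01// lee_fin powR_ge0.
    by apply: ereal_sup_ubound; exists 0 => //=; rewrite in_itv/= lexx ltr01.
  - by rewrite in_itv/= leey andbT lee_fin powR_ge0.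
  apply: ge_ereal_sup => _ [r /= + <-]; rewrite in_itv/= => r01.
  rewrite circle_meanE// lee_fin; apply: ge0_ler_powR; rewrite ?nnegrE ?(ltW p0)//.
    exact: circle_norm_ge0.
  exact: HB.
have fin : (hardy_norm p f < +oo)%E by exact: le_lt_trans le (ltry _).
split=> //; rewrite /hnorm; rewrite -lee_fin fineK//.
by rewrite ge0_fin_numE// poweR_ge0.
Qed.

Lemma holomorphicD f g : holomorphic_disk f -> holomorphic_disk g -> holomorphic_disk (fun z => f z + g z).
Proof.
move=> hf hg z z1; have := @derivableD _ R[i]^o R[i]^o f g z 1 (hf z z1) (hg z z1).
by apply.
Qed.

Lemma holomorphicZ c f : holomorphic_disk f -> holomorphic_disk (fun z => c * f z).
Proof.
by move=> hf z z1; have := @derivableZ _ R[i]^o R[i]^o f c z 1 (hf z z1); apply.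
Qed.

Lemma holomorphic_cst c : holomorphic_disk (fun=> c).
Proof.
by move=> z z1; have := @derivable_cst _ R[i]^o R[i]^o c z 1; apply.
Qed.

Lemma holomorphic_mulX w f : holomorphic_disk f -> holomorphic_disk (fun z => (z - w) * f z).
Proof.
move=> hf z z1.
have d1 := @derivable_id _ R[i]^o z 1.
have d2 := @derivableD _ R[i]^o R[i]^o _ _ z 1 d1 (@derivable_cst _ R[i]^o R[i]^o (- w) z 1).
by have := @derivableM _ R[i]^o _ _ z 1 d2 (hf z z1); apply.
Qed.

Lemma hardyZ c f : hardy p f ->
  hardy p (fun z => c * f z) /\ hnorm (fun z => c * f z) <= cabs c * hnorm f.
Proof.
move=> hf; apply: hnorm_le.
- exact/holomorphicZ/hf.1.
- by rewrite mulr_ge0 ?cabs_ge0 ?hnorm_ge0.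
move=> r r01; rewrite circle_normZ//; last exact: hf.1.
by rewrite ler_wpM2l ?cabs_ge0// circle_norm_le_hnorm.
Qed.

Lemma hnormZ c f : hardy p f -> hnorm (fun z => c * f z) = cabs c * hnorm f.
Proof.
move=> hf; have [hcf le] := hardyZ c hf.
apply/eqP; rewrite eq_le le /=.
have [->|c0] := eqVneq c 0; first by rewrite normc0 mul0r hnorm_ge0.
have [_] := hardyZ c^-1 hcf.
have -> : (fun z => c^-1 * (c * f z)) = f.
  by apply/funext => z; rewrite mulrA mulVf// mul1r.
have cc0 : 0 < cabs c.
  by rewrite lt_neqAle cabs_ge0 andbT eq_sym; apply: contra_neq c0; exact: eq0_normc.
by rewrite normcV -ler_pdivrMl ?invr_gt0// invrK.
Qed.

Lemma hnorm_cst c : hardy p (fun=> c) /\ hnorm (fun=> c) = cabs c.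
Proof.
have cst r : circle_norm (fun=> c) r = cabs c.
  by rewrite /circle_norm /lp_norm average_cst -powRrM mulfV ?gt_eqF// powRr1// cabs_ge0.
have [|hc le] := hnorm_le (@holomorphic_cst c) (cabs_ge0 c); first by move=> r _; rewrite cst.
split=> //; apply/eqP; rewrite eq_le le /= -(cst 0).
by rewrite circle_norm_le_hnorm// lexx ltr01.
Qed.

Lemma hnorm_ge_at0 f : hardy p f -> cabs (f 0) <= hnorm f.
Proof. by move=> hf; rewrite -circle_norm0 circle_norm_le_hnorm// lexx ltr01. Qed.

Let r := pyth_r p.
Let C := parallelogram_const p.

Lemma pyth_r_gt1 : 1 < pyth_r p.
Proof. by rewrite /pyth_r; case: ifPn => // _; lra. Qed.

Lemma parallelogram_const_gt0 : 0 < parallelogram_const p.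
Proof. by rewrite /parallelogram_const; case: ifPn => // _; rewrite subr_gt0. Qed.

Let r0 : 0 < r. Proof. exact: lt_trans ltr01 pyth_r_gt1. Qed.

Let powR_r_mono x y : 0 <= x -> x <= y -> x `^ r <= y `^ r.
Proof.
move=> x0 xy; apply: ge0_ler_powR => //; first exact: ltW.
by rewrite nnegrE (le_trans x0 xy).
Qed.

Lemma le_root x y : 0 <= x -> x `^ r <= y -> x <= y `^ r^-1.
Proof.
move=> x0 xy; have -> : x = (x `^ r) `^ r^-1.
  by rewrite -powRrM mulfV ?gt_eqF// powRr1.
apply: ge0_ler_powR; rewrite ?nnegrE ?powR_ge0//; first by rewrite invr_ge0 ltW.
exact: le_trans (powR_ge0 _ _) xy.
Qed.

(** The bound on all circles also proves finiteness, which is how membership in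
    the Hardy space is transported. *)
Lemma hnorm_powR_le f B : holomorphic_disk f ->
  (forall a, 0 <= a < 1 -> circle_norm f a `^ r <= B) -> hardy p f /\ hnorm f `^ r <= B.
Proof.
move=> hf HB.
have B0 : 0 <= B.
  by apply: le_trans (HB 0 _); rewrite ?powR_ge0// lexx ltr01.
have [|hh le] := hnorm_le hf (powR_ge0 B r^-1).
  by move=> a a01; apply: le_root; [exact: circle_norm_ge0|exact: HB].
split=> //; have -> : B = (B `^ r^-1) `^ r.
  by rewrite -powRrM mulVf ?gt_eqF// powRr1.
by apply: ge0_ler_powR; rewrite ?nnegrE ?powR_ge0 ?hnorm_ge0 ?(ltW r0).
Qed.

Let le_div_add x y B k : 0 < k -> y <= (B - x) / k -> x + k * y <= B.
Proof. by move=> k0; rewrite ler_pdivlMr// mulrC lerBrDr addrC. Qed.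

Let le_sub_div x y B k : 0 < k -> x <= B - k * y -> y <= (B - x) / k.
Proof. by move=> k0; rewrite ler_pdivlMr// => H; rewrite mulrC; lra. Qed.

(* Unification would otherwise compare two norms by unfolding them into
   suprema of integrals. *)
Opaque hnorm circle_norm.

(** The law holds on each circle. Since the norms on circles increase with the
    radius, it also holds with different radii for [f + g] and [f - g]: pass to the
    larger one. The two suprema can then be taken independently. *)
Lemma hardy_parallelogram f g : hardy p f -> hardy p g ->
  [/\ hardy p (fun z => f z + g z), hardy p (fun z => f z - g z) &
   hnorm (fun z => f z + g z) `^ r + C * hnorm (fun z => f z - g z) `^ r <=
   2 `^ (r - 1) * (hnorm f `^ r + hnorm g `^ r)].
Proof.
move=> hf hg.
have hD := holomorphicD hf.1 hg.1.
have hB : holomorphic_disk (fun z => f z - g z).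
  have -> : (fun z => f z - g z) = (fun z => f z + -1 * g z).
    by apply/funext => z; rewrite mulN1r.
  exact/holomorphicD/holomorphicZ/hg.1/hf.1.
set B := 2 `^ (r - 1) * _.
have C0 : 0 < C := parallelogram_const_gt0.
have same a : 0 <= a < 1 -> circle_norm (fun z => f z + g z) a `^ r +
    C * circle_norm (fun z => f z - g z) a `^ r <= B.
  move=> a01; have a1 : `|a| < 1 by rewrite ger0_norm; lra.
  apply: le_trans (parallelogram p1 (ccontinuous_circle hf.1 a1) (ccontinuous_circle hg.1 a1)) _.
  apply: ler_wpM2l; first exact: powR_ge0.
  have Hf := powR_r_mono (circle_norm_ge0 f a) (circle_norm_le_hnorm hf a01).
  have Hg := powR_r_mono (circle_norm_ge0 g a) (circle_norm_le_hnorm hg a01).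
  exact: (lerD Hf Hg).
have cross a b : 0 <= a < 1 -> 0 <= b < 1 -> circle_norm (fun z => f z + g z) a `^ r +
    C * circle_norm (fun z => f z - g z) b `^ r <= B.
  move=> a01 b01; have m01 : 0 <= Num.max a b < 1.
    by rewrite le_max gt_max; case/andP: a01 => -> ->; case/andP: b01 => _ ->.
  apply: le_trans (same _ m01); case/andP: a01 => a0 a1; case/andP: b01 => b0 b1.
  case/andP: m01 => _ m1.
  have am : a <= Num.max a b by rewrite le_max lexx.
  have bm : b <= Num.max a b by rewrite le_max lexx orbT.
  have Ha := powR_r_mono (circle_norm_ge0 _ _) (circle_norm_mono hD a0 am m1).
  have Hb := powR_r_mono (circle_norm_ge0 _ _) (circle_norm_mono hB b0 bm m1).
  exact: (lerD Ha (ler_wpM2l (ltW C0) Hb)).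
have step1 b : 0 <= b < 1 -> hardy p (fun z => f z + g z) /\
   hnorm (fun z => f z + g z) `^ r <= B - C * circle_norm (fun z => f z - g z) b `^ r.
  by move=> b01; apply: hnorm_powR_le => // a a01; rewrite lerBrDr cross.
have [|hardyB le] := @hnorm_powR_le (fun z => f z - g z)
    ((B - hnorm (fun z => f z + g z) `^ r) / C) hB.
  by move=> b b01; have [_] := step1 b b01; exact: le_sub_div.
have z01 : 0 <= (0 : R) < 1 by rewrite lexx ltr01.
split; [exact: (step1 0 z01).1|exact: hardyB|].
exact: (le_div_add C0 le).
Qed.

(** Finiteness of the norm of the sum is a by-product of the parallelogram law. *)
Lemma hardyD f g : hardy p f -> hardy p g -> hardy p (fun z => f z + g z).
Proof. by move=> hf hg; case: (hardy_parallelogram hf hg). Qed.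

Let powR2_gt1 e : 0 < e -> 1 < 2 `^ e.
Proof.
move=> e0; have := @gt0_ltr_powR R e e0 1 2; rewrite powR1; apply; rewrite ?nnegrE//.
by rewrite ltr1n.
Qed.

(** The constant that [halving_iteration] yields for ratio [2^(1-r)]. *)
Lemma pyth_KE : pyth_K p = C * 2 `^ (1 - r) / (1 - 2 `^ (1 - r)).
Proof.
have E : 2 `^ (1 - r) = (2 `^ (r - 1))^-1 by rewrite -powRN opprB.
rewrite E /C /pyth_K /parallelogram_const /r /pyth_r; case: ifPn => [p2|].
  have -> : (2 : R) - 1 = 1 by ring.
  by rewrite (powRr1 (ler0n R 2)); field.
rewrite -ltNge => p2.
have pw : 1 < 2 `^ (p - 1) by apply: powR2_gt1; lra.
move: (2 `^ (p - 1)) pw => u u1.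
by field; rewrite gt_eqF//= ?subr_gt0//; lra.
Qed.

(** The parallelogram law for [f + t g] and [f], with [t = 2^-n], in terms of the
    norms [x] of [f + (t / 2) g], [y] of [g], [u] of [f] and [v] of [f + t g]. *)
Let halving_step x y u v n : 0 <= x -> 0 <= y ->
  (2 * x) `^ r + C * (2 ^- n * y) `^ r <= 2 `^ (r - 1) * (v `^ r + u `^ r) ->
  2 * (x `^ r - u `^ r) + C * 2 `^ (1 - r) * y `^ r * (2 `^ (1 - r) / 2) ^+ n <=
  v `^ r - u `^ r.
Proof.
move=> x0 y0.
have two_n : (0 : R) <= 2 ^- n by rewrite invr_ge0 exprn_ge0.
have w0 : 0 < 2 `^ (r - 1) by rewrite powR_gt0.
have -> : 2 `^ (1 - r) = (2 `^ (r - 1))^-1 by rewrite -powRN opprB.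
have two_r : 2 `^ r = 2 * 2 `^ (r - 1) by rewrite mulr_powRB1.
rewrite (powRM _ (ler0n R 2) x0) (powRM _ two_n y0).
have -> : (2 ^- n) `^ r = (2 `^ r)^-1 ^+ n.
  rewrite -(powR_inv1 (exprn_ge0 n (ler0n R 2))) -powRrM mulN1r powRN exprVn; congr _^-1.
  by rewrite -(powR_mulrn n (ler0n R 2)) -(powR_mulrn n (powR_ge0 2 r)) powRAC.
rewrite two_r; have -> : (2 `^ (r - 1))^-1 / 2 = (2 * 2 `^ (r - 1))^-1.
  by rewrite invfM mulrC.
move: (2 `^ (r - 1)) w0 => w w0.
move: (_ ^+ n) (x `^ r) (y `^ r) (u `^ r) (v `^ r) => q X Y U V H.
rewrite -(ler_pM2l w0).
have -> : w * (2 * (X - U) + C / w * Y * q) = 2 * w * X + C * (q * Y) - 2 * w * U.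
  by field; rewrite gt_eqF.
lra.
Qed.

Lemma hardy_pythagoras f g : hardy p f -> hardy p g ->
  (forall t : R, hnorm f <= hnorm (fun z => f z + t%:C%C * g z)) ->
  hnorm f `^ r + pyth_K p * hnorm g `^ r <= hnorm (fun z => f z + g z) `^ r.
Proof.
move=> hf hg orth.
pose N n := hnorm (fun z => f z + (2 ^- n)%:C%C * g z) `^ r.
pose d n := N n - hnorm f `^ r.
have h2n n : hardy p (fun z => (2 ^- n)%:C%C * g z) by case: (hardyZ (2 ^- n)%:C%C hg).
have d0 n : 0 <= d n.
  by rewrite subr_ge0; exact: (powR_r_mono (hnorm_ge0 f) (orth _)).
set s := 2 `^ (1 - r); set c := C * s * hnorm g `^ r.
have r1 := pyth_r_gt1; rewrite -/r in r1.
have s0 : 0 < s by rewrite powR_gt0.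
have s1 : s < 1.
  by rewrite /s -opprB powRN invf_lt1 ?powR_gt0// powR2_gt1//; lra.
have dS n : 2 * d n.+1 + c * (s / 2) ^+ n <= d n.
  have [_ _] := hardy_parallelogram (hardyD hf (h2n n)) hf.
  have -> : (fun z => f z + (2 ^- n)%:C%C * g z + f z) =
     (fun z => 2%:R%:C%C * (f z + (2 ^- n.+1)%:C%C * g z)).
    apply/funext => z; rewrite [in RHS]mulrDr [in RHS]mulrA -rmorphM/=.
    have -> : 2%:R * 2 ^- n.+1 = 2 ^- n :> R.
      by rewrite exprS invfM mulrA mulfV// mul1r.
    by rewrite rmorph_nat; ring.
  have -> : (fun z => f z + (2 ^- n)%:C%C * g z - f z) = (fun z => (2 ^- n)%:C%C * g z).
    by apply/funext => z; rewrite addrC addKr.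
  rewrite (hnormZ _ (hardyD hf (h2n n.+1))) (hnormZ _ hg).
  have two_n : (0 : R) <= 2 ^- n by rewrite invr_ge0 exprn_ge0.
  rewrite (cabs_real (ler0n R 2)) (cabs_real two_n) => H.
  exact: (halving_step (hnorm_ge0 _) (hnorm_ge0 g) H).
have := halving_iteration s0 s1 d0 dS.
rewrite {1}/d /N expr0 invr1 pyth_KE.
have -> : (fun z => f z + 1%:C%C * g z) = (fun z => f z + g z).
  by apply/funext => z; rewrite rmorph1 mul1r.
rewrite /c -/s; have -> : C * s * hnorm g `^ r / (1 - s) = C * s / (1 - s) * hnorm g `^ r.
  by rewrite mulrAC.
by rewrite lerBrDr addrC.
Qed.
End Hardy.

(** * Optimal approximants of degree one *)

Section DegreeOne.
Context {R : realType}.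
Implicit Types (p : R) (f : R[i] -> R[i]) (z w a c : R[i]).

Lemma hardy_mulX p f w : 1 < p -> hardy p f -> hardy p (fun z => (z - w) * f z).
Proof.
move=> p1 hf; have p0 : 0 < p := lt_trans ltr01 p1.
have k0 : 0 <= 1 + cabs w by rewrite addr_ge0 ?cabs_ge0.
apply: (hnorm_le p1 (holomorphic_mulX hf.1) (mulr_ge0 k0 (hnorm_ge0 p f)) _).1 => r r01.
apply: le_trans (ler_wpM2l k0 (circle_norm_le_hnorm p1 hf r01)).
rewrite -(cabs_real k0) -(circle_normZ p1 _ hf.1 r01).
apply: (le_circle_norm p1 (holomorphic_mulX hf.1) (holomorphicZ hf.1) r01) => t.
rewrite !normcM ler_wpM2r ?cabs_ge0// cabs_real//.
apply: le_trans (cabsD _ _) _; rewrite cabsN cabs_circle_pt lerD2r.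
by case/andP: r01 => r0 r1; rewrite ger0_norm// ltW.
Qed.

(** If [w] is not 0 the product does not vanish at the origin. If [w = 0], the
    norm of [z f z] on the circle of radius 1/2 is half that of [f], which is at
    least [|f 0|] by monotonicity. *)
Lemma hnorm_mulX_gt0 p f w : 1 < p -> hardy p f -> f 0 != 0 ->
  0 < hnorm p (fun z => (z - w) * f z).
Proof.
move=> p1 hf f0; have hF := hardy_mulX w p1 hf.
have cabs_gt0 z : z != 0 -> 0 < cabs z.
  move=> z0; rewrite lt_neqAle cabs_ge0 andbT eq_sym.
  by apply: contra_neq z0; exact: eq0_normc.
have [w0|w0] := eqVneq w 0; last first.
  apply: lt_le_trans (hnorm_ge_at0 p1 hF).
  by rewrite cabs_gt0// mulf_neq0// sub0r oppr_eq0.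
have h01 : 0 <= (2^-1 : R) < 1 by rewrite invr_ge0 ler0n invf_lt1// ltr1n.
apply: lt_le_trans (circle_norm_le_hnorm p1 hF h01).
have le : circle_norm p (fun z => (2^-1)%:C%C * f z) 2^-1 <=
    circle_norm p (fun z => (z - w) * f z) 2^-1.
  apply: (le_circle_norm p1 (holomorphicZ hf.1) (holomorphic_mulX hf.1) h01) => t.
  by rewrite w0 subr0 !normcM cabs_circle_pt cabs_real ?invr_ge0// ger0_norm.
apply: lt_le_trans le.
rewrite circle_normZ//; last exact: hf.1.
rewrite cabs_real ?invr_ge0// mulr_gt0// ?invr_gt0//.
apply: (@lt_le_trans _ _ (circle_norm p f 0)).
  by rewrite circle_norm0// cabs_gt0.
by case/andP: h01 => ? ?; apply: circle_norm_mono => //; exact: hf.1.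
Qed.

(** The competitor is the multiple [(1 - t) q] of the optimal approximant. *)
Lemma opa_orthogonal p f q a w : 1 < p -> hardy p f -> is_opa p 1 f q ->
  (forall z, q.[z] = a * (z - w)) -> forall t : R,
  hnorm p (fun z => 1 + - a * ((z - w) * f z)) <=
  hnorm p (fun z => 1 + - a * ((z - w) * f z) + t%:C%C * (a * ((z - w) * f z))).
Proof.
move=> p1 hf [sq qmin] qaw t.
have hF := hardy_mulX w p1 hf.
have [h1 _] := hnorm_cst p1 1.
have hx : hardy p (fun z => 1 + - a * ((z - w) * f z)).
  exact/(hardyD p1 h1)/(hardyZ p1 (- a) hF).1.
have hxy : hardy p (fun z => 1 + - a * ((z - w) * f z) + t%:C%C * (a * ((z - w) * f z))).
  exact/(hardyD p1 hx)/(hardyZ p1 _ (hardyZ p1 a hF).1).1.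
have := qmin ((1 - t)%:C%C *: q) (leq_trans (size_scale_leq _ _) sq).
have -> : (fun z => 1 - q.[z] * f z) = (fun z => 1 + - a * ((z - w) * f z)).
  by apply/funext => z; rewrite qaw; ring.
have -> : (fun z => 1 - ((1 - t)%:C%C *: q).[z] * f z) =
    (fun z => 1 + - a * ((z - w) * f z) + t%:C%C * (a * ((z - w) * f z))).
  by apply/funext => z; rewrite hornerZ qaw rmorphB rmorph1; ring.
have fin g : hardy p g -> hardy_norm p g \is a fin_num.
  by case=> _ lt; rewrite ge0_fin_numE// poweR_ge0.
by move=> le; apply: fine_le => //; exact: fin.
Qed.

Lemma opa_bound p f q a w : 1 < p -> hardy p f -> f 0 != 0 -> is_opa p 1 f q ->
  (forall z, q.[z] = a * (z - w)) ->
  (cabs a) `^ (pyth_r p - 1) <=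
    (pyth_r p * cabs (w * f 0)) /
    (pyth_K p * hnorm p (fun z => (z - w) * f z + w * f 0) `^ (pyth_r p) +
     pyth_K p * hnorm p (fun z => (z - w) * f z) `^ (pyth_r p)).
Proof.
move=> p1 hf hf0 hq hqaw.
have hF := hardy_mulX w p1 hf.
have nF := hnorm_mulX_gt0 w p1 hf hf0.
have hc c := (hnorm_cst p1 c).1.
have hFw : hardy p (fun z => (z - w) * f z + w * f 0) by exact: (hardyD p1 hF (hc (w * f 0))).
set r := pyth_r p; have r1 : 1 < r := pyth_r_gt1 p1.
set c := 1 + a * (w * f 0).
(* [1 - a F] is orthogonal to [a F]. *)
have first_step : hnorm p (fun z => 1 + - a * ((z - w) * f z)) `^ r +
    pyth_K p * (cabs a * hnorm p (fun z => (z - w) * f z)) `^ r <= 1.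
  have hx : hardy p (fun z => 1 + - a * ((z - w) * f z)).
    exact: (hardyD p1 (hc 1) (hardyZ p1 (- a) hF).1).
  have := hardy_pythagoras p1 hx (hardyZ p1 a hF).1 (opa_orthogonal p1 hf hq hqaw).
  have -> : (fun z => 1 + - a * ((z - w) * f z) + a * ((z - w) * f z)) = (fun=> 1).
    by apply/funext => z; ring.
  by rewrite (hnorm_cst p1 1).2 normc1 powR1 (hnormZ p1 a hF).
(* The constant [c] is orthogonal to [- a (F + w f(0))]. *)
have second_step : cabs c `^ r +
    pyth_K p * (cabs a * hnorm p (fun z => (z - w) * f z + w * f 0)) `^ r <=
    hnorm p (fun z => 1 + - a * ((z - w) * f z)) `^ r.
  have hy := (hardyZ p1 (- a) hFw).1.
  have orth (t : R) : hnorm p (fun=> c) <=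
      hnorm p (fun z => c + t%:C%C * (- a * ((z - w) * f z + w * f 0))).
    rewrite (hnorm_cst p1 c).2.
    have := hnorm_ge_at0 p1 (hardyD p1 (hc c) (hardyZ p1 t%:C%C hy).1).
    have -> : c + t%:C%C * (- a * ((0 - w) * f 0 + w * f 0)) = c by ring.
    by [].
  have := hardy_pythagoras p1 (hc c) hy orth.
  have -> : (fun z => c + - a * ((z - w) * f z + w * f 0)) =
      (fun z => 1 + - a * ((z - w) * f z)).
    by apply/funext => z; rewrite /c; ring.
  by rewrite (hnorm_cst p1 c).2 (hnormZ p1 _ hFw) cabsN.
have ca : 1 - cabs a * cabs (w * f 0) <= cabs c.
  rewrite -normcM lerBlDr.
  have {1}-> : 1 = cabs (c + - (a * (w * f 0))) by rewrite /c addrK normc1.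
  by apply: le_trans (cabsD _ _) _; rewrite cabsN.
have bern := powR_ge_bernoulli r1 (cabs_ge0 c).
have K0 : 0 < pyth_K p.
  rewrite /pyth_K; case: ifPn => [_|]; first by rewrite subr_gt0.
  rewrite -ltNge => p2; rewrite invr_gt0 subr_gt0.
  have := @gt0_ltr_powR R (p - 1) _ 1 2; rewrite powR1; apply; rewrite ?nnegrE ?ltr1n//.
  by rewrite subr_gt0.
move: (hnorm_ge0 p (fun z => (z - w) * f z + w * f 0)) nF first_step second_step.
move: (hnorm p (fun z => (z - w) * f z + w * f 0)) => N1.
move: (hnorm p (fun z => (z - w) * f z)) => N2.
move: (hnorm p _ `^ r) => X N10 N20.
rewrite !powRM ?cabs_ge0 ?(ltW N20)// => S1 S2.
have den : 0 < pyth_K p * N1 `^ r + pyth_K p * N2 `^ r.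
  by rewrite ltr_wpDl ?mulr_ge0 ?powR_ge0 ?mulr_gt0 ?powR_gt0// ltW.
rewrite ler_pdivlMr//.
have [->|a0] := eqVneq a 0.
  rewrite normc0 powR0 ?mul0r ?mulr_ge0 ?cabs_ge0//; first exact: ltW (lt_trans ltr01 r1).
  by rewrite subr_eq0 gt_eqF.
have ca0 : 0 < cabs a.
  by rewrite lt_neqAle cabs_ge0 andbT eq_sym; apply: contra_neq a0; exact: eq0_normc.
rewrite -(ler_pM2l ca0) mulrA (mulr_powRB1 (cabs_ge0 a) (lt_trans ltr01 r1)).
have rca := ler_wpM2l (ltW (lt_trans ltr01 r1)) ca.
lra.
Qed.

End DegreeOne.

(* The norms in the statement below are written out. *)
Transparent hnorm.

Theorem proposition4p4 (R : realType) (p : R) (hp : 1 < p)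
    (f : R[i] -> R[i]) (hf : hardy p f) (hf0 : f 0 != 0)
    (q : {poly R[i]}) (hq : is_opa p 1 f q)
    (a w : R[i]) (hqaw : forall z : R[i], q.[z] = a * (z - w)) :
  (cabs a) `^ (pyth_r p - 1) <=
    (pyth_r p * cabs (w * f 0)) /
    (pyth_K p *
       fine (hardy_norm p (fun z => (z - w) * f z + w * f 0)) `^ (pyth_r p) +
     pyth_K p *
       fine (hardy_norm p (fun z => (z - w) * f z)) `^ (pyth_r p)).
Proof. exact: opa_bound hp hf hf0 hq hqaw. Qed.
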